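(* Let $I,J,L\subset S$ be such that $I\cup J\subset L$ and $L$ is finitary. Let $p$ be an $(I,J)$-coset contained in $W_L$, and let $K=\operatorname{LR}(p)=I\cap\underline{p}J\underline{p}^{-1}$ be its left redundancy. Then there exists a pair of dual bases for $R^K$ over $R^I$ (with respect to the trace map $\partial^K_I\colon R^K\to R^I$) such that one of the two bases is contained in the image of $\partial_{\underline{p}}$ viewed as a map $R^J\to R^K$.
   Context: Let $(W,S)$ be a Coxeter system with length function $\ell$ and Coxeter matrix $(m_{st})$. For $I\subset S$, $W_I$ is the subgroup generated by $I$; $I$ is finitary if $W_I$ is finite, and then $w_I$ is its longest element and $\ell(I):=\ell(w_I)$. Let $\Bbbk$ be a field. A realization is a finite-dimensional $\Bbbk$-vector space $V$ with roots $\alpha_s\in V$ and coroots $\alpha_s^\vee\in V^*$ ($s\in S$), $\langle\alpha_s^\vee,\alpha_s\rangle=2$, such that $s(v)=v-\langle\alpha_s^\vee,v\rangle\alpha_s$ defines an action of $W$ on $V$, and such that $[m_{st}]_s=[m_{st}]_t=0$ whenever $m_{st}<\infty$; here, with $a_{st}=\langle\alpha_s^\vee,\alpha_t\rangle$, $[0]_s=[0]_t=0$, $[1]_s=[1]_t=1$, $[2]_s=-a_{st}$, $[2]_t=-a_{ts}$, $[k+1]_s=[2]_s[k]_t-[k-1]_s$, $[k+1]_t=[2]_t[k]_s-[k-1]_t$. It is balanced if $[m_{st}-1]_s=[m_{st}-1]_t=1$ whenever $m_{st}<\infty$, and faithful if $W$ acts faithfully on $V$. Let $V$ be a faithful balanced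 realization satisfying generalized Demazure surjectivity (below). $R=\operatorname{Sym}(V)$, graded with $\deg V=2$; $R^I$ is the ring of $W_I$-invariants. $\partial_s\colon R\to R^s$, $\partial_s(f)=(f-s(f))/\alpha_s$; these satisfy $\partial_s^2=0$ and the braid relations, so $\partial_x:=\partial_{s_1}\cdots\partial_{s_d}$ is well defined for any reduced expression $x=s_1\cdots s_d$. Set $\partial_I:=\partial_{w_I}$ for $I$ finitary, and $\partial^I_J:=\partial_{w_Jw_I^{-1}}\colon R^I\to R^J$ for $I\subset J$ finitary. Generalized Demazure surjectivity: $\partial_I\colon R\to R^I$ is surjective for all finitary $I$. For $I,J$ finitary, an $(I,J)$-coset is an element $p\in W_I\backslash W/W_J$; $\underline{p}$ is its minimal element in Bruhat order. The operator $\partial_{\underline{p}}$ maps $R^J$ into $R^K$ for $K=I\cap\underline{p}J\underline{p}^{-1}$. A pair of dual bases for $R^K$ over $R^I$ ($K\subset I$) means finite homogeneous bases $\{c_i\}$, $\{d_i\}$ of $R^K$ as a free $R^I$-module with $\partial^K_I(c_id_j)=\delta_{ij}$. *)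

(* Defs.v *)
From HB Require Import structures.
From mathcomp Require Import all_boot all_order all_algebra.
From mathcomp Require Import boolp classical_sets functions cardinality.
From mathcomp Require Import mpoly.

Set Implicit Arguments.
Unset Strict Implicit.
Unset Printing Implicit Defensive.

Import GRing.Theory.

Local Open Scope classical_set_scope.
Local Open Scope ring_scope.

(* [cox_equiv m] is the congruence on words generated by (st)^(m s t) ~ 1.
   The value m s t = 0 encodes m_st = oo: the relator is then the empty word.
   Since m s s = 1 in a Coxeter matrix, s^2 ~ 1, so that words modulo this
   congruence form the group presented by the Coxeter matrix. *)
Inductive cox_equiv (S : Type) (m : S -> S -> nat) : seq S -> seq S -> Prop :=
| CoxRefl u : cox_equiv m u u
| CoxSym u v : cox_equiv m u v -> cox_equiv m v u
| CoxTrans u v w : cox_equiv m u v -> cox_equiv m v w -> cox_equiv m u w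
| CoxRel u v s t :
    cox_equiv m (u ++ flatten (nseq (m s t) [:: s; t]) ++ v) (u ++ v).

Record coxeter_system := CoxeterSystem {
  cox_group :> groupType;
  cox_index : choiceType;
  cox_gen : cox_index -> cox_group;
  cox_mat : cox_index -> cox_index -> nat;
  cox_mat_sym : forall s t, cox_mat s t = cox_mat t s;
  cox_mat_diag : forall s t, (cox_mat s t == 1%N) = (s == t);
  cox_generates : forall x : cox_group,
    exists u : seq cox_index, x = (\prod_(s <- u) cox_gen s)%g;
  cox_presentation : forall u v : seq cox_index,
    (\prod_(s <- u) cox_gen s)%g = (\prod_(s <- v) cox_gen s)%g <->
    cox_equiv cox_mat u v
}.
Arguments cox_gen {_} _.
Arguments cox_mat {_} _ _.

Definition cox_word (C : coxeter_system) (u : seq (cox_index C)) : C :=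
  (\prod_(s <- u) cox_gen s)%g.

Definition reduced_expr (C : coxeter_system) (x : C) (u : seq (cox_index C)) :=
  cox_word u = x /\
  forall v : seq (cox_index C), cox_word v = x -> (size u <= size v)%N.

Definition redex (C : coxeter_system) (x : C) : seq (cox_index C) :=
  xget [::] [set u | reduced_expr x u].

Definition cox_length (C : coxeter_system) (x : C) : nat := size (redex x).

Definition reflection (C : coxeter_system) (t : C) : Prop :=
  exists (w : C) (s : cox_index C), t = (w * cox_gen s * w^-1)%g.

Inductive bruhat (C : coxeter_system) (x : C) : C -> Prop :=
| BruhatRefl : bruhat x x
| BruhatStep y t : bruhat x y -> reflection t ->
    (cox_length y < cox_length (y * t)%g)%N -> bruhat x (y * t)%g.

Definition is_subgroup (G : groupType) (H : set G) : Prop :=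
  [/\ H 1%g, forall x y, H x -> H y -> H (x * y)%g
    & forall x, H x -> H x^-1%g].

Definition parabolic (C : coxeter_system) (I : set (cox_index C)) : set C :=
  smallest (@is_subgroup C) (cox_gen @` I).

Definition finitary (C : coxeter_system) (I : set (cox_index C)) : Prop :=
  finite_set (parabolic I).

(* The element w_I; it is only meaningful when I is finitary. *)
Definition longest (C : coxeter_system) (I : set (cox_index C)) : C :=
  xget 1%g [set w | parabolic I w /\
                    forall x, parabolic I x -> (cox_length x <= cox_length w)%N].

Definition is_dcoset (C : coxeter_system) (I J : set (cox_index C))
    (p : set C) : Prop :=
  exists x : C,
    p = [set (u * x * v)%g | u in parabolic I & v in parabolic J].

Definition dcoset_min (C : coxeter_system) (p : set C) : C :=
  xget 1%g [set x | p x /\ forall y, p y -> bruhat x y].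

(* I ∩ p_ J p_^-1, where p_ is the minimal element of p and the subsets I, J of
   S are viewed inside the group. *)
Definition left_redundancy (C : coxeter_system) (I J : set (cox_index C))
    (p : set C) : set (cox_index C) :=
  [set s | I s /\ exists2 t, J t &
     cox_gen s = (dcoset_min p * cox_gen t * (dcoset_min p)^-1)%g].

(* With x = [2]_s and y = [2]_t, [two_color x y k] is [k]_s and
   [two_color y x k] is [k]_t. *)
Fixpoint two_color (k : fieldType) (x y : k) (n : nat) : k :=
  match n with
  | 0%N => 0
  | n1.+1 => match n1 with
             | 0%N => 1
             | n2.+1 => x * two_color y x n1 - two_color x y n2
             end
  end.

(* The conditions on [m_st]_s and [m_st]_t concern pairs s <> t; those on
   [m_st]_t are obtained by exchanging s and t, m being symmetric. *)
Record realization (k : fieldType) (C : coxeter_system) := Realization {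
  rspace :> vectType k;
  root : cox_index C -> rspace;
  coroot : cox_index C -> 'Hom(rspace, k^o);
  coroot_root : forall s, coroot s (root s) = 2%:R;
  ract : C -> 'End(rspace);
  ract1 : forall v, ract 1%g v = v;
  ractM : forall x y v, ract (x * y)%g v = ract x (ract y v);
  ract_gen : forall s v,
    ract (cox_gen s) v = v - (coroot s v : k) *: root s;
  real_quantum : forall s t, s != t -> (0 < cox_mat s t)%N ->
    two_color (- (coroot s (root t) : k)) (- (coroot t (root s) : k))
      (cox_mat s t) = 0
}.
Arguments root {k C} _ _.
Arguments coroot {k C} _ _.
Arguments ract {k C} _ _.

Definition balanced (k : fieldType) (C : coxeter_system)
    (V : realization k C) : Prop :=
  forall s t, s != t -> (0 < cox_mat s t)%N ->
    two_color (- (coroot V s (root V t) : k)) (- (coroot V t (root V s) : k))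
      (cox_mat s t).-1 = 1.

Definition faithful_realization (k : fieldType) (C : coxeter_system)
    (V : realization k C) : Prop :=
  injective (ract V).

(* Sym(V) is the polynomial algebra on the vectors of a basis of V; [sym_inj]
   is the canonical embedding V -> Sym(V). *)
Definition Sym (k : fieldType) (V : vectType k) := {mpoly k[\dim {: V}]}.

Definition sym_inj (k : fieldType) (V : vectType k) (v : V) : Sym V :=
  \sum_(i < \dim {: V}) coord (vbasis {: V}) i v *: 'X_i.

(* The algebra endomorphism of Sym(V) extending g : V -> V. *)
Definition sym_map (k : fieldType) (V : vectType k) (g : 'End(V))
    (f : Sym V) : Sym V :=
  f \mPo [tuple sym_inj (g (tnth (vbasis {: V}) i)) | i < \dim {: V}].

Definition sym_act (k : fieldType) (C : coxeter_system) (V : realization k C)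
    (x : C) (f : Sym V) : Sym V :=
  sym_map (ract V x) f.

Definition invariants (k : fieldType) (C : coxeter_system)
    (V : realization k C) (I : set (cox_index C)) : set (Sym V) :=
  [set f | forall x : C, parabolic I x -> sym_act x f = f].

(* Generators have polynomial degree 1 here, instead of 2; this does not affect
   which elements are homogeneous. *)
Definition homogeneous (k : fieldType) (V : vectType k) (f : Sym V) : Prop :=
  exists e : nat, f \is e.-homog.

(* The quotient (f - s(f)) / alpha_s; it is unique because Sym(V) is a domain and
   alpha_s != 0 as soon as V is faithful. *)
Definition demazure_gen (k : fieldType) (C : coxeter_system)
    (V : realization k C) (s : cox_index C) (f : Sym V) : Sym V :=
  xget 0 [set q : Sym V | q * sym_inj (root V s) = f - sym_act (cox_gen s) f].

(* By the braid relations the choice of the reduced expression is irrelevant. *)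
Definition demazure (k : fieldType) (C : coxeter_system)
    (V : realization k C) (x : C) (f : Sym V) : Sym V :=
  foldr (@demazure_gen k C V) f (redex x).

(* The trace map ∂^I_J : R^I -> R^J, for I ⊂ J. *)
Definition demazure_trace (k : fieldType) (C : coxeter_system)
    (V : realization k C) (I J : set (cox_index C)) (f : Sym V) : Sym V :=
  demazure (longest J * (longest I)^-1)%g f.

Definition demazure_surjective (k : fieldType) (C : coxeter_system)
    (V : realization k C) : Prop :=
  forall I : set (cox_index C), finitary I ->
  forall f : Sym V, invariants I f ->
  exists g : Sym V, demazure (longest I) g = f.

Definition homogeneous_basis (k : fieldType) (C : coxeter_system)
    (V : realization k C) (K I : set (cox_index C)) (n : nat)
    (c : 'I_n -> Sym V) : Prop :=
  (forall i, invariants K (c i) /\ homogeneous (c i)) /\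
  (forall f : Sym V, invariants K f ->
   exists! a : {ffun 'I_n -> Sym V},
     (forall i, invariants I (a i)) /\ f = \sum_(i < n) a i * c i).

Definition dual_bases (k : fieldType) (C : coxeter_system)
    (V : realization k C) (K I : set (cox_index C)) (n : nat)
    (c d : 'I_n -> Sym V) : Prop :=
  [/\ homogeneous_basis K I c, homogeneous_basis K I d
    & forall i j, demazure_trace K I (c i * d j) = (i == j)%:R].

(* Main.v *)
Require Import Defs.
From HB Require Import structures.
From mathcomp Require Import all_boot all_order all_algebra all_field.
From mathcomp Require Import boolp classical_sets functions cardinality.
From mathcomp Require Import mpoly zify ring.

Set Implicit Arguments.
Unset Strict Implicit.
Unset Printing Implicit Defensive.

Import GRing.Theory.

Local Open Scope classical_set_scope.
Local Open Scope ring_scope.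

(** Proof idea.  Let x be the minimal element of p, let w_I, w_J, w_K, w_L be the
    longest elements, and put y = x w_J; then l(y) = l(x) + l(w_J), and the image
    of d_y lies in d_x(R^J) and in R^K.  By surjectivity there are homogeneous e
    and f with d_{w_I} e = 1 and d_{w_L} f = 1.  For b in W_I such that b^-1 is
    minimal in b^-1 W_K put z_b = (b^-1 y)^-1 w_L and
      c_b = d_y (d_{z_b} f),      d_b = d_{w_K} (d_b e).
    Since the trace from R^K to R^I composed with d_{w_K} is d_{w_I}, and d_b is
    adjoint to d_{b^-1} for the form d_{w_I} (f g),
      tr (c_b' d_b) = d_{w_I} (d_{b^-1} (c_b') e).
    Kilmoyer's description of W_I ∩ x W_J x^-1 gives l(b^-1 y) = l(b) + l(y), so
    d_{b^-1} (c_b') = d_{b^-1 y} (d_{z_b'} f), which has degree l(b') - l(b): it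
    is 0 if l(b) > l(b'), and if l(b) = l(b') it is 1 or 0 according to whether
    b = b'.  The Gram matrix is thus unitriangular, and replacing the d_b by
    suitable R^I-combinations yields dual families.  They are bases because the
    pairing is nondegenerate: if h in R^K is nonzero, take b in W_I of maximal
    length with d_{b^-1} h != 0; this element is W_I-invariant, so
    d_{w_I} (d_{b^-1} (h) e) = d_{b^-1} h != 0.

    The composition rule d_x d_y = d_{xy} or 0 needs the braid relations; these
    hold with exponent m_st, so Matsumoto's theorem is needed with the exact
    order of s t, which is read off from the geometric representation. *)

(** * Words and the exchange condition *)

Definition alt (T : Type) (s t : T) (n : nat) : seq T :=
  (fix alt_rec s t n := if n is n'.+1 then s :: alt_rec t s n' else [::]) s t n.

Section Alternating.
Variables (T : Type) (s t : T).

Lemma altS n : alt s t n.+1 = s :: alt t s n.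
Proof. by []. Qed.

Lemma size_alt n : size (alt s t n) = n.
Proof. by rewrite /alt; elim: n s t => //= n IHn a b; rewrite IHn. Qed.

End Alternating.

Lemma alt_cat (T : Type) (s t : T) m n :
  alt s t (m + n) = alt s t m ++ (if odd m then alt t s n else alt s t n).
Proof.
elim: m s t => [|m IHm] s t; first by rewrite add0n.
by rewrite addSn !altS cat_cons IHm /=; case: (odd m).
Qed.

Lemma alt_rcons (T : Type) (s t : T) n :
  alt s t n.+1 = rcons (alt s t n) (if odd n then t else s).
Proof. by rewrite -addn1 alt_cat -cats1; case: (odd n). Qed.

Lemma rev_alt (T : Type) (s t : T) n :
  rev (alt s t n) = if odd n then alt s t n else alt t s n.
Proof.
elim: n s t => // n IHn s t.
rewrite altS rev_cons IHn /=; case: (boolP (odd n)) => /= on.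
  by rewrite [RHS]alt_rcons on.
by rewrite -altS [RHS]alt_rcons (negbTE on).
Qed.

Lemma flatten_nseq_alt (T : Type) (s t : T) m :
  flatten (nseq m [:: s; t]) = alt s t m.*2.
Proof. by elim: m => //= m ->. Qed.

Definition del (T : Type) (i : nat) (u : seq T) := take i u ++ drop i.+1 u.

Lemma size_del (T : Type) i (u : seq T) :
  (i < size u)%N -> size (del i u) = (size u).-1.
Proof.
by move=> iu; rewrite size_cat size_take size_drop iu; move: iu; lia.
Qed.

Lemma mem_del (T : eqType) i (u : seq T) x : x \in del i u -> x \in u.
Proof. by rewrite mem_cat => /orP[/mem_take|/mem_drop]. Qed.

Lemma del_cat (T : Type) i (u v : seq T) : del i (u ++ v) =
  if (i < size u)%N then del i u ++ v else u ++ del (i - size u) v.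
Proof.
rewrite /del take_cat drop_cat; case: (ltnP i (size u)) => iu.
  rewrite -catA; case: ltnP => // ui.
  have -> : i.+1 = size u by lia.
  by rewrite subnn drop0 drop_size.
by rewrite ltnNge (leq_trans iu) //= subSn // catA.
Qed.

Section Coxeter.
Variable C : coxeter_system.
Implicit Types (s t : cox_index C) (u v : seq (cox_index C)).
Implicit Types (x y z w : C) (I J K : set (cox_index C)).

Local Notation g := (@cox_gen C).
Local Notation wd := (@cox_word C).
Local Notation len := (@cox_length C).

(* Instance of [mulgA] whose product is syntactically the one of [C], as [lia]
   requires. *)
Lemma cox_mulA x y z : (x * (y * z) = x * y * z)%g.
Proof. exact: mulgA. Qed.

Lemma cox_word_nil : wd [::] = 1%g.
Proof. by rewrite /cox_word big_nil. Qed.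

Lemma cox_word_cons s u : wd (s :: u) = (g s * wd u)%g.
Proof. by rewrite /cox_word big_cons. Qed.

Lemma cox_word_cat u v : wd (u ++ v) = (wd u * wd v)%g.
Proof. by rewrite /cox_word big_cat. Qed.

Lemma cox_word1 s : wd [:: s] = g s.
Proof. by rewrite cox_word_cons cox_word_nil mulg1. Qed.

Lemma cox_word_rcons u s : wd (rcons u s) = (wd u * g s)%g.
Proof. by rewrite -cats1 cox_word_cat cox_word1. Qed.

Lemma cox_word_altM s t n : wd (alt s t n.*2) = ((g s * g t) ^+ n)%g.
Proof.
elim: n => [|n IHn]; first by rewrite cox_word_nil expg0.
by rewrite doubleS !altS !cox_word_cons IHn expgS mulgA.
Qed.

Lemma cox_rel s t : wd (alt s t (cox_mat s t).*2) = 1%g.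
Proof.
rewrite -flatten_nseq_alt -(cats0 (flatten _)) -[_ ++ [::]]cat0s -cox_word_nil.
exact: (cox_presentation _ _).2 (CoxRel cox_mat [::] [::] s t).
Qed.

Lemma cox_genK s : (g s * g s)%g = 1%g.
Proof.
have := cox_rel s s; have /eqP -> : cox_mat s s == 1%N by rewrite cox_mat_diag.
by rewrite cox_word_altM expg1.
Qed.

Lemma cox_genV s : (g s)^-1%g = g s.
Proof. exact: mulg1_eq (cox_genK s). Qed.

Lemma cox_genKl s x : (g s * (g s * x))%g = x.
Proof. by rewrite mulgA cox_genK mul1g. Qed.

Lemma cox_genKr s x : (x * g s * g s)%g = x.
Proof. by rewrite -mulgA cox_genK mulg1. Qed.

Lemma cox_wordV u : (wd u)^-1%g = wd (rev u).
Proof.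
elim: u => [|s u IHu]; first by rewrite cox_word_nil invg1.
by rewrite cox_word_cons invgM IHu cox_genV rev_cons cox_word_rcons.
Qed.

Lemma redex_reduced x : reduced_expr x (redex x).
Proof.
apply: xgetPex => /=; have [u0 xE] := cox_generates x.
have ex : exists n, `[< exists2 u, wd u = x & size u = n >].
  by exists (size u0); apply/asboolP; exists u0.
have [n /asboolP[u ux un] nmin] := ex_minnP ex.
exists u; split=> // v vx; rewrite un; apply: nmin; apply/asboolP.
by exists v.
Qed.

Lemma cox_word_redex x : wd (redex x) = x.
Proof. by case: (redex_reduced x). Qed.

Lemma len_word u : (len (wd u) <= size u)%N.
Proof. exact: (redex_reduced (wd u)).2. Qed.

Definition reduced u := len (wd u) == size u.

Lemma redexP x : reduced (redex x).
Proof. by rewrite /reduced cox_word_redex. Qed.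

Lemma len1 : len 1%g = 0%N.
Proof. by apply/eqP; rewrite -leqn0 -cox_word_nil len_word. Qed.

Lemma len0 x : len x = 0%N -> x = 1%g.
Proof. by move/size0nil => r; rewrite -(cox_word_redex x) r cox_word_nil. Qed.

Lemma lenV x : len x^-1%g = len x.
Proof.
suff le y : (len y^-1%g <= len y)%N.
  by apply/eqP; rewrite eqn_leq le -{1}(invgK x) le.
by rewrite -{1}(cox_word_redex y) cox_wordV (leq_trans (len_word _)) // size_rev.
Qed.

Lemma lenM x y : (len (x * y)%g <= len x + len y)%N.
Proof.
rewrite -{1}(cox_word_redex x) -{1}(cox_word_redex y) -cox_word_cat.
by rewrite (leq_trans (len_word _)) // size_cat.
Qed.

Lemma len_gen_le s : (len (g s) <= 1)%N.
Proof. by rewrite -cox_word1 len_word. Qed.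

(* The parity of the number of occurrences of r among the reflections
   s_1 .. s_i .. s_1 attached to the word u = s_1 s_2 .. . *)
Fixpoint par u (r : C) : bool :=
  if u is s :: u' then (r == g s) (+) par u' (r ^ g s)%g else false.

Lemma par_cat u v r : par (u ++ v) r = par u r (+) par v (r ^ wd u)%g.
Proof.
elim: u r => [|s u IHu] r /=; first by rewrite cox_word_nil conjg1.
by rewrite IHu cox_word_cons conjgM addbA.
Qed.

Lemma par_alt s t n r :
  par (alt s t n) r = \big[addb/false]_(i < n) (r == (g s * g t) ^+ i * g s)%g.
Proof.
elim: n s t r => [|n IHn] s t r; first by rewrite big_ord0.
rewrite altS /= IHn big_ord_recl expg0 mul1g; congr (_ (+) _).
apply: eq_bigr => i _; rewrite lift0.
have -> : ((g s * g t) ^+ i.+1 * g s)%g = (((g t * g s) ^+ i * g t) ^ g s)%g.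
  rewrite conjgE cox_genV !mulgA; congr (_ * _)%g.
  elim: (nat_of_ord i) => [|j IHj]; first by rewrite expg1 expg0 mulg1.
  by rewrite expgSr IHj expgSr !mulgA.
by apply/eqP/eqP => [<-|->]; rewrite -conjgM cox_genK conjg1.
Qed.

(** Since (st)^m = 1, the 2m reflections attached to (st)^m run twice through the same m elements,
    so each parity is even. *)
Lemma par_rel s t r : par (alt s t (cox_mat s t).*2) r = false.
Proof.
rewrite par_alt -addnn big_split_ord /=; set A := (X in X (+) _).
set B := (X in _ (+) X); suff -> : B = A by rewrite addbb.
apply: eq_bigr => i _; rewrite expgnDr.
by have := cox_rel s t; rewrite cox_word_altM => ->; rewrite mul1g.
Qed.

(** By [par_cat] and [par_rel] the parity respects the presentation, so it may be computed on any
    word of an element, in particular on a reduced one. *)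
Lemma par_word u v r : wd u = wd v -> par u r = par v r.
Proof.
move=> /cox_presentation uv; elim: uv r => //.
- by move=> u1 u2 u3 _ IH1 _ IH2 r; rewrite IH1 IH2.
- move=> u1 u2 s t r; rewrite flatten_nseq_alt !par_cat par_rel addFb.
  by rewrite -conjgM cox_rel mulg1.
Qed.

(** If r is the reflection attached to the i-th letter, multiplication by r cancels that letter. *)
Lemma par_del u r : par u r ->
  exists2 i, (i < size u)%N & (r * wd u)%g = wd (del i u).
Proof.
elim: u r => //= s u IHu r; case: eqVneq => [-> _|_ /= /IHu[i iu e]].
  by exists 0%N => //; rewrite cox_word_cons cox_genKl /del /= drop0.
exists i.+1 => //; rewrite /del /= !cox_word_cons -/(del i u) -e conjgE.
by rewrite !mulgA mulgV mul1g.
Qed.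

(** Prefixing s flips the parity at s, so s is attached to a reduced word of s u; deleting the
    matching letter there shows that u is shorter. *)
Lemma par_gen s u : ~~ par u (g s) -> (len (wd u) < len (g s * wd u)%g)%N.
Proof.
move=> nu; set w := (g s * _)%g.
have : par (redex w) (g s).
  rewrite (@par_word _ (s :: u)) ?cox_word_redex ?cox_word_cons //=.
  by rewrite eqxx conjgE mulgA mulVg mul1g (negbTE nu).
move=> /par_del[i iw]; rewrite cox_word_redex {1}/w cox_genKl => e.
rewrite [in X in (X < _)%N]e (leq_ltn_trans (len_word _)) // size_del //.
by move: iw; rewrite /cox_length; lia.
Qed.

Lemma exchange s u : (len (g s * wd u)%g <= len (wd u))%N ->
  exists2 i, (i < size u)%N & (g s * wd u)%g = wd (del i u).
Proof.
move=> le; apply: par_del; apply: contraLR le => /par_gen.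
by rewrite -ltnNge.
Qed.

(** By [par_cat] the parity on u ++ v is a sum of two parities; a factor where it is odd loses a
    letter. *)
Lemma exchange_cat s u v : (len (g s * wd u * wd v)%g <= len (wd u * wd v)%g)%N ->
  (exists2 i, (i < size u)%N & (g s * wd u)%g = wd (del i u)) \/
  (exists2 i, (i < size v)%N & (g s * wd u * wd v)%g = (wd u * wd (del i v))%g).
Proof.
rewrite -mulgA -cox_word_cat => le.
have : par (u ++ v) (g s) by apply: contraLR le => /par_gen; rewrite -ltnNge.
rewrite par_cat; case: (boolP (par u (g s))) => [/par_del|_ /= /par_del[i iv e]].
  by left.
right; exists i => //; rewrite -e conjgE cox_word_cat !mulgA mulgV mul1g.
by rewrite -!mulgA.
Qed.

Lemma exchange_cat3 s u v v' :
  (len (g s * wd u * wd v * wd v')%g <= len (wd u * wd v * wd v')%g)%N ->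
  [\/ exists2 i, (i < size u)%N & (g s * wd u)%g = wd (del i u),
      exists2 i, (i < size v)%N & (g s * wd u * wd v)%g = (wd u * wd (del i v))%g
    | exists2 i, (i < size v')%N &
        (g s * wd u * wd v * wd v')%g = (wd u * wd v * wd (del i v'))%g].
Proof.
move=> le; have := @exchange_cat s (u ++ v) v'.
rewrite !cox_word_cat mulgA => /(_ le)[[i]|]; last by move=> ?; apply: Or33.
have [iu _ e|ui iuv e] := ltnP i (size u).
  apply: Or31; exists i => //; apply: (mulIg (wd v)).
  by rewrite e del_cat iu cox_word_cat.
apply: Or32; exists (i - size u)%N.
  by move: iuv; rewrite size_cat; lia.
by rewrite e del_cat ltnNge ui /= cox_word_cat.
Qed.

(** Equal lengths would let [exchange] write s x with one letter fewer than x has. *)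
Lemma len_genM_neq s x : len (g s * x)%g != len x.
Proof.
rewrite -(cox_word_redex x); set u := redex x.
apply/eqP => e; have [i iu ei] := @exchange s u (eq_leq e).
have := len_word (del i u); rewrite -ei e size_del // (eqP (redexP x)) -/u.
by move: iu; lia.
Qed.

Lemma len_genMP s x :
  len (g s * x)%g = (len x).+1 \/ len x = (len (g s * x)%g).+1.
Proof.
have := len_genM_neq s x; have := lenM (g s) x; have := lenM (g s) (g s * x)%g.
rewrite cox_genKl; have := len_gen_le s.
case: (ltngtP (len (g s * x)%g) (len x)) => // ? ? ? ? _; [right|left]; lia.
Qed.

Lemma len_gen s : len (g s) = 1%N.
Proof.
have := len_genMP s 1%g; rewrite mulg1 len1 => -[//|].
by move=> /esym.
Qed.

Lemma reduced_cons s u :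
  reduced (s :: u) = reduced u && (len (wd u) < len (g s * wd u)%g)%N.
Proof.
rewrite /reduced cox_word_cons /=; have := len_word u.
by case: (len_genMP s (wd u)); lia.
Qed.

End Coxeter.

(** * The order of a product of two generators *)

Lemma big_ord_double (V : nmodType) (F : nat -> V) n :
  \sum_(j < n.*2) F j = \sum_(i < n) (F i.*2 + F i.*2.+1).
Proof.
elim: n => [|n IHn]; first by rewrite !big_ord0.
by rewrite doubleS !big_ord_recr /= IHn addrA.
Qed.

Section TitsRepresentation.
Variable C : coxeter_system.
Local Notation S := (cox_index C).
Implicit Types (s t q : S) (f : S -> algC).

(* For m = 0, i.e. m_st = oo, the root 1 makes the product of the two
   reflections unipotent. *)
Definition tits_root m : algC :=
  if m is m'.+1 then sval (C_prim_root_exists (ltn0Sn m'.*2.+1)) else 1.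

Lemma tits_rootP m : (0 < m)%N -> (m.*2).-primitive_root (tits_root m).
Proof. by case: m => // m _; rewrite /tits_root; case: C_prim_root_exists. Qed.

(** For z a primitive 2m-th root of unity, -(z + 1/z) is a Galois conjugate of -2 cos(pi/m): up to
    this choice it is twice the usual Tits form, without real numbers. *)
Definition tits_form s t : algC :=
  if s == t then 2%:R else
    - (tits_root (cox_mat s t) + (tits_root (cox_mat s t))^-1).

(** Dual of the geometric representation: f q is the value of a linear form at the simple root q.
    Arbitrary functions on S spare finite-support conditions when S is infinite. *)
Definition tits_refl s f : S -> algC := fun q => f q - f s * tits_form s q.

Definition tits_act (u : seq S) f : S -> algC := foldr tits_refl f u.

Lemma tits_act_cat u v f : tits_act (u ++ v) f = tits_act u (tits_act v f).
Proof. exact: foldr_cat. Qed.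

Lemma tits_formxx s : tits_form s s = 2%:R.
Proof. by rewrite /tits_form eqxx. Qed.

Lemma tits_formC s t : tits_form s t = tits_form t s.
Proof. by rewrite /tits_form eq_sym cox_mat_sym. Qed.

(** r j is the value at the letter of the j-th reflection applied, counted from 0, and that
    reflection subtracts r j times a row of the form. The conditional in w keeps t as the letter
    applied first. *)
Lemma tits_act_alt s t f (r : nat -> algC) : s != t ->
    r 0%N = f t -> r 1%N = f s - tits_form s t * f t ->
    (forall n, r n.+2 = - tits_form s t * r n.+1 - r n) ->
  forall n, let w := if odd n then alt t s n else alt s t n in
  [/\ tits_act w f (if odd n then s else t) = r n,
      tits_act w f (if odd n then t else s) = r n.+1 + tits_form s t * r n
    & forall q, tits_act w f q =
        f q - \sum_(j < n) r j * tits_form (if odd j then s else t) q].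
Proof.
move=> st r0 r1 rS; elim=> [|n [IH1 IH2 IH3]] /=.
  by split=> // [|q]; rewrite ?big_ord0 ?subr0 // r1 r0 subrK.
have -> : (if ~~ odd n then alt t s n.+1 else alt s t n.+1) =
  (if odd n then s else t) :: (if odd n then alt t s n else alt s t n).
  by case: (odd n).
move: IH1 IH2 IH3; set w := (X in tits_act X f) => IH1 IH2 IH3.
split=> [||q] /=; last first.
- by rewrite /tits_refl IH1 IH3 big_ord_recr /= opprD addrA.
- rewrite if_neg /tits_refl IH1 rS tits_formxx; ring.
rewrite if_neg /tits_refl IH1 IH2.
have -> : tits_form (if odd n then s else t) (if odd n then t else s) =
    tits_form s t by case: (odd n) => //; rewrite tits_formC.
ring.
Qed.

Lemma tits_act_rel s t f : tits_act (alt s t (cox_mat s t).*2) f = f.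
Proof.
have [<-|st] := eqVneq s t.
  have /eqP -> : cox_mat s s == 1%N by rewrite cox_mat_diag.
  by apply/funext => q; rewrite /= /tits_refl tits_formxx; ring.
set m := cox_mat s t; have [m0|m0] := posnP m; first by rewrite m0.
have m1 : (1 < m)%N.
  by rewrite ltn_neqAle m0 andbT eq_sym cox_mat_diag.
have zP := tits_rootP m0; set z := tits_root m in zP.
have z0 : z != 0 by rewrite (prim_root_eq0 zP) double_eq0 -lt0n.
have z2 : z ^+ 2 != 1.
  by rewrite -(prim_order_dvd zP) gtnNdvd // -[2%N]/1.*2 ltn_double.
have zV : z - z^-1 != 0.
  apply: contra z2; rewrite subr_eq0 => /eqP e.
  by rewrite expr2 {1}e mulVf.
have Bst : tits_form s t = - (z + z^-1) by rewrite /tits_form (negbTE st).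
(* The characteristic roots of the recurrence are z and 1/z; a is fixed by the initial values r 0
   and r 1. *)
pose a := (f s - tits_form s t * f t - z^-1 * f t) / (z - z^-1).
pose r n := a * z ^+ n + (f t - a) * z^-1 ^+ n.
(* Corrections of even and of odd index cancel separately: they are combinations of geometric sums
   in z^2 and z^-2 over m terms. *)
have sum0 (x : algC) : x ^+ 2 != 1 -> x ^+ m.*2 = 1 ->
    \sum_(i < m) x ^+ i.*2 = 0.
  move=> x2 xm; apply/eqP; move: (subrX1 (x ^+ 2) m).
  rewrite -exprM mul2n xm subrr => /esym/eqP.
  rewrite mulf_eq0 subr_eq0 (negbTE x2) /=.
  by under eq_bigr do rewrite -exprM mul2n.
have zm : z ^+ m.*2 = 1 by rewrite (prim_expr_order zP).
have zVm : z^-1 ^+ m.*2 = 1 by rewrite exprVn zm invr1.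
have zV2 : z^-1 ^+ 2 != 1 by rewrite exprVn invr_eq1.
have sum_r e : \sum_(i < m) r (i.*2 + e)%N = 0.
  rewrite big_split /=; under eq_bigr do rewrite exprD mulrA.
  under [X in _ + X]eq_bigr do rewrite exprD mulrA.
  by rewrite -!mulr_suml -!mulr_sumr !sum0 // !mulr0 !mul0r addr0.
have r0 : r 0%N = f t by rewrite /r !expr0 !mulr1 addrC subrK.
have r1 : r 1%N = f s - tits_form s t * f t.
  have : a * (z - z^-1) = f s - tits_form s t * f t - z^-1 * f t.
    by rewrite divfK.
  rewrite mulrBr /r !expr1 mulrBl => e.
  transitivity (a * z - a * z^-1 + z^-1 * f t); first ring.
  by rewrite e; ring.
have rS n : r n.+2 = - tits_form s t * r n.+1 - r n.
  rewrite Bst /r !exprS.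
  have zz : z * z^-1 = 1 by rewrite divff.
  set y := z^-1 in zz *; set b := f t - a.
  transitivity ((z + y) * (a * (z * z ^+ n) + b * (y * y ^+ n))
     - (z * y) * (a * z ^+ n + b * y ^+ n)); first ring.
  by rewrite zz; ring.
have [_ _] := tits_act_alt st r0 r1 rS m.*2; rewrite odd_double => e.
apply/funext => q; rewrite e.
rewrite (big_ord_double (fun j => r j * tits_form (if odd j then s else t) q)).
under eq_bigr do rewrite /= odd_double /=.
rewrite big_split /= -!mulr_suml.
have := sum_r 0%N; under eq_bigr do rewrite addn0; move=> ->.
have := sum_r 1%N; under eq_bigr do rewrite addn1; move=> ->.
by rewrite !mul0r addr0 subr0.
Qed.

Lemma tits_act_word (u v : seq S) f :
  cox_word u = cox_word v -> tits_act u f = tits_act v f.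
Proof.
move=> /cox_presentation uv; elim: uv f => //.
- by move=> u1 u2 u3 _ IH1 _ IH2 f; rewrite IH1 IH2.
- move=> u1 u2 s t f; rewrite flatten_nseq_alt !tits_act_cat.
  by rewrite tits_act_rel.
Qed.

(* Together with [cox_rel], the order of g s * g t is exactly m_st. *)
Lemma cox_order s t n : s != t -> (0 < n)%N ->
  cox_word (alt s t n.*2) = 1%g -> (0 < cox_mat s t)%N && (cox_mat s t %| n)%N.
Proof.
move=> st n0 w1.
have act1 f : tits_act (alt s t n.*2) f = f.
  by rewrite (@tits_act_word _ [::]) // w1 cox_word_nil.
set m := cox_mat s t; pose z := tits_root m.
have Bst : tits_form s t = - (z + z^-1) by rewrite /tits_form (negbTE st).
have [m0|m0] := posnP m.
  (* With B(s,t) = -2 this form gives r n = n, so its value at t would pass from 0 to 2n. *)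
  pose f q : algC := (q == s)%:R.
  have z1 : z = 1 by rewrite /z m0.
  have := @tits_act_alt s t f (fun n => n%:R) st; rewrite Bst z1 invr1.
  rewrite /f eq_sym (negbTE st) eqxx mulr0 subr0.
  case/(_ erefl erefl _ n.*2) => [k|].
    by rewrite -natr1 -(natr1 k); ring.
  rewrite odd_double act1 eq_sym (negbTE st) => /esym/eqP.
  by rewrite Num.Theory.pnatr_eq0 double_eq0 -leqn0 leqNgt n0.
have zP := tits_rootP m0; rewrite -/z in zP.
have z0 : z != 0 by rewrite (prim_root_eq0 zP) double_eq0 -lt0n.
have zz : z * z^-1 = 1 by rewrite divff.
(* This choice isolates the root z: r n = z^n, so the relation forces z^(2n) = 1. *)
pose f q : algC := if q == s then - z^-1 else 1.
have fs : f s = - z^-1 by rewrite /f eqxx.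
have ft : f t = 1 by rewrite /f eq_sym (negbTE st).
have := @tits_act_alt s t f (fun n => z ^+ n) st; rewrite ft fs Bst.
case/(_ _ _ _ n.*2) => [//||k|].
- by rewrite expr1; ring.
- by rewrite !exprS; apply/eqP; rewrite -subr_eq0; apply/eqP;
    transitivity ((z * z^-1 - 1) * - z ^+ k); [ring | rewrite zz; ring].
rewrite odd_double act1 ft => /esym/eqP; rewrite -(prim_order_dvd zP).
by rewrite -!muln2 dvdn_pmul2r.
Qed.

End TitsRepresentation.

(** * Parabolic subgroups and minimal coset representatives *)

Section Parabolic.
Variable C : coxeter_system.
Implicit Types (s t : cox_index C) (u v : seq (cox_index C)).
Implicit Types (x y z w : C) (I J K : set (cox_index C)).

Local Notation g := (@cox_gen C).
Local Notation wd := (@cox_word C).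
Local Notation len := (@cox_length C).

Lemma parabolic_subgroup I : is_subgroup (parabolic I).
Proof.
split=> [|x y Px Py|x Px] M [SM IM].
- by case: SM.
- by case: (SM) => _ + _; apply; [apply: Px|apply: Py].
- by case: (SM) => _ _; apply; apply: Px.
Qed.

Lemma parabolic1 I : parabolic I (1%g : C).
Proof. by case: (parabolic_subgroup I). Qed.

Lemma parabolicM I x y : parabolic I x -> parabolic I y -> parabolic I (x * y)%g.
Proof. by case: (parabolic_subgroup I) => _ + _; apply. Qed.

Lemma parabolicV I x : parabolic I x -> parabolic I x^-1%g.
Proof. by case: (parabolic_subgroup I) => _ _; apply. Qed.

Lemma parabolic_gen I s : I s -> parabolic I (g s).
Proof. by move=> Is; apply: sub_gen_smallest; exists s. Qed.

Lemma parabolicS I J : I `<=` J -> parabolic I `<=` parabolic J.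
Proof.
move=> IJ; apply: smallest_sub; first exact: parabolic_subgroup.
by move=> _ [s Is <-]; apply: parabolic_gen; exact: IJ.
Qed.

Lemma parabolic_word I u : (forall s, s \in u -> I s) -> parabolic I (wd u).
Proof.
elim: u => [|s u IHu] uI; first by rewrite cox_word_nil; exact: parabolic1.
rewrite cox_word_cons; apply: parabolicM.
  by apply: parabolic_gen; apply: uI; rewrite inE eqxx.
by apply: IHu => t tu; apply: uI; rewrite inE tu orbT.
Qed.

Definition word_in I u := forall s, s \in u -> I s.

Lemma word_in_cons I s u : word_in I (s :: u) <-> I s /\ word_in I u.
Proof.
split=> [H|[Is uI] t]; last by rewrite inE => /orP[/eqP->//|/uI].
split; first by apply: H; rewrite inE eqxx.
by move=> t tu; apply: H; rewrite inE tu orbT.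
Qed.

(** Shortening by [exchange] only deletes letters, so I is never left: the length on W_I is the
    restriction of the length on W. *)
Lemma reduce_word I u : word_in I u ->
  exists v, [/\ reduced v, wd v = wd u & word_in I v].
Proof.
elim: u => [|s u IHu].
  by exists [::]; split; rewrite // /reduced cox_word_nil len1.
move=> /word_in_cons[Is /IHu[v [rv vu vI]]].
have [|le] := ltnP (len (wd v)) (len (g s * wd v)%g).
  exists (s :: v); split; first by rewrite reduced_cons rv.
    by rewrite !cox_word_cons vu.
  by apply/word_in_cons.
have [i iv e] := exchange le; exists (del i v); split.
- rewrite /reduced -e size_del //; move: rv => /eqP.
  by case: (len_genMP s (wd v)) le; lia.
- by rewrite -e cox_word_cons vu.
- by move=> t /mem_del /vI.
Qed.

Lemma parabolicP I x :
  parabolic I x <-> exists u, [/\ reduced u, wd u = x & word_in I u].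
Proof.
split; last by move=> [u [_ <- /parabolic_word]].
suff : parabolic I `<=` [set x | exists2 u, wd u = x & word_in I u].
  by move=> sub /sub[u <- /reduce_word].
apply: smallest_sub; last first.
  move=> _ [s Is <-]; exists [:: s]; rewrite ?cox_word1 // => t.
  by rewrite inE => /eqP->.
split=> [|_ _ [u <- uI] [v <- vI]|_ [u <- uI]].
- by exists [::]; rewrite ?cox_word_nil.
- exists (u ++ v); first by rewrite cox_word_cat.
  by move=> s; rewrite mem_cat => /orP[/uI|/vI].
- by exists (rev u); rewrite ?cox_wordV // => s; rewrite mem_rev => /uI.
Qed.

Lemma parabolic_len1 I x : parabolic I x -> len x = 1%N -> exists2 s, I s & x = g s.
Proof.
move=> /parabolicP[u [/eqP ru <- uI]]; rewrite ru.
case: u {ru} uI => [|s [|t u]] //= uI _.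
exists s; last by rewrite cox_word1.
by apply: uI; rewrite inE eqxx.
Qed.

Lemma longestP I : finitary I -> parabolic I (longest I) /\
  forall x, parabolic I x -> (len x <= len (longest I))%N.
Proof.
move=> /finite_seqP[r Ir]; 
pose P := [set w : C | parabolic I w /\ forall x, parabolic I x -> (len x <= len w)%N].
apply: (@xgetPex _ 1%g P) => /=.
have ex : exists n, `[< exists2 x, parabolic I x & len x = n >].
  by exists (len 1%g); apply/asboolP; exists 1%g => //; exact: parabolic1.
have bd n : `[< exists2 x, parabolic I x & len x = n >] ->
    (n <= \max_(x <- r) len x)%N.
  move=> /asboolP[x]; rewrite Ir /= => xr <-.
  exact: leq_bigmax_seq.
have [n /asboolP[x Ix xn] nmax] := ex_maxnP ex bd.
exists x; split=> // y Iy; rewrite xn; apply: nmax.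
by apply/asboolP; exists y.
Qed.

(** Along a reduced word of u, the letter exchanged for s cannot lie in the prefix v, as s v is
    longer than v; it lies in the rest, so s v is again a prefix of w. *)
Lemma descents_prefix I w (u : C) : (forall s, I s -> (len (g s * w)%g < len w)%N) ->
  parabolic I u -> len w = (len u + len (u^-1 * w)%g)%N.
Proof.
move=> Iw /parabolicP[v [+ <-]]; elim: v => [|s v IHv].
  by rewrite cox_word_nil len1 invg1 mul1g.
rewrite reduced_cons => /andP[rv sv] /word_in_cons[Is vI].
have {IHv} := IHv rv vI; set z := ((wd v)^-1 * w)%g => lw.
have wE : w = (wd v * wd (redex z))%g by rewrite cox_word_redex mulVKg.
have le : (len (g s * wd v * wd (redex z)) <= len (wd v * wd (redex z)))%N.
  by rewrite -cox_mulA -wE ltnW // Iw.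
have [[i iv e]|[i iz e]] := exchange_cat le.
  have := len_word (del i v); rewrite -e size_del // -(eqP rv); lia.
have swE : ((wd (s :: v))^-1 * w)%g = wd (del i (redex z)).
  have : (g s * w)%g = (wd v * wd (del i (redex z)))%g by rewrite -e -mulgA -wE.
  rewrite cox_word_cons invgM cox_genV -mulgA => ->.
  by rewrite mulKg.
have := len_word (del i (redex z)); rewrite -swE size_del //.
have := lenM (wd (s :: v)) ((wd (s :: v))^-1 * w)%g; rewrite mulVKg.
move: sv iz lw; rewrite cox_word_cons -/(len z).
have := lenM (g s) (wd v); rewrite len_gen; lia.
Qed.

Lemma longest_descent I s : finitary I -> I s ->
  (len (g s * longest I)%g < len (longest I))%N.
Proof.
move=> /longestP[Iw max] Is.
have := max _ (parabolicM (parabolic_gen Is) Iw).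
by case: (len_genMP s (longest I)); lia.
Qed.

Lemma longest_left I (u : C) : finitary I -> parabolic I u ->
  len (longest I) = (len u + len (u^-1 * longest I)%g)%N.
Proof. by move=> fI; apply: descents_prefix => s; exact: longest_descent. Qed.

Lemma longest_right I (u : C) : finitary I -> parabolic I u ->
  len (longest I) = (len (longest I * u^-1)%g + len u)%N.
Proof.
move=> fI Iu; have [Iw max] := longestP fI.
rewrite -(lenV (longest I)) addnC -(lenV (_ * _)%g) invgM -lenV invgK -(lenV u).
have : len (longest I)^-1%g = (len u^-1%g + len (u^-1^-1 * (longest I)^-1)%g)%N.
  apply: descents_prefix; last exact: parabolicV Iu.
  move=> s Is; have := max _ (parabolicM (parabolic_gen Is) (parabolicV Iw)).
  by case: (len_genMP s (longest I)^-1%g); rewrite !lenV; lia.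
by rewrite lenV.
Qed.

Definition min_left I x := forall u : C, parabolic I u -> (len x <= len (u * x)%g)%N.

Definition min_right I x := forall u : C, parabolic I u -> (len x <= len (x * u)%g)%N.

(** An exchange inside the word of u contradicts its reducedness; one inside x would give an element
    of W_I x shorter than x. *)
Lemma min_left_len I x (u : C) : min_left I x -> parabolic I u ->
  len (u * x)%g = (len u + len x)%N.
Proof.
move=> mx /parabolicP[v [+ <-]]; elim: v => [|s v IHv].
  by rewrite cox_word_nil len1 mul1g.
rewrite reduced_cons => /andP[rv sv] /word_in_cons[Is vI].
have {IHv} lv := IHv rv vI.
have [lt|le] := ltnP (len (wd v * x)%g) (len (g s * wd v * x)%g).
  rewrite cox_word_cons; move: lt sv; rewrite -cox_mulA.
  by case: (len_genMP s (wd v)) (len_genMP s (wd v * x)%g) => ? [] ?; lia.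
rewrite -(cox_word_redex x) in le; have [[i iv e]|[i ix e]] := exchange_cat le.
  have := len_word (del i v); rewrite -e size_del // -(eqP rv); lia.
have Iv := parabolic_word vI.
have := mx _ (parabolicM (parabolicM (parabolicV Iv) (parabolic_gen Is)) Iv).
rewrite -{2}(cox_word_redex x) -!mulgA (mulgA (g s)) e mulKg.
have := len_word (del i (redex x)); rewrite size_del // -/(len x) => a b.
by move: (leq_trans b a) ix; rewrite -/(len x); lia.
Qed.

Lemma min_leftV I x : min_left I x^-1%g <-> min_right I x.
Proof.
split=> m u Iu; first by have := m _ (parabolicV Iu); rewrite -invgM !lenV.
by rewrite -[(u * _)%g]invgK invgM invgK !lenV m //; exact: parabolicV.
Qed.

Lemma min_right_len I x (u : C) : min_right I x -> parabolic I u ->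
  len (x * u)%g = (len x + len u)%N.
Proof.
move=> /min_leftV mx /parabolicV Iu.
by have := min_left_len mx Iu; rewrite -invgM !lenV addnC.
Qed.

Lemma min_right_ex I x : exists2 u : C, parabolic I u & min_right I (x * u)%g.
Proof.
have ex : exists n, `[< exists2 u : C, parabolic I u & len (x * u)%g = n >].
  by exists (len (x * 1)%g); apply/asboolP; exists 1%g => //; exact: parabolic1.
have [n /asboolP[u Iu xn] nmin] := ex_minnP ex.
exists u => // v Iv; rewrite xn; apply: nmin; apply/asboolP.
by exists (u * v)%g; [exact: parabolicM | rewrite mulgA].
Qed.

End Parabolic.

(** * Matsumoto's theorem *)

Section Matsumoto.
Variable C : coxeter_system.
Implicit Types (s t : cox_index C) (u v : seq (cox_index C)).
Implicit Types (x y z w : C) (I J K : set (cox_index C)).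

Local Notation g := (@cox_gen C).
Local Notation wd := (@cox_word C).
Local Notation len := (@cox_length C).

Lemma cox_word_alt_double s t k :
  wd (alt s t k.*2) = (wd (alt s t k) * (wd (alt t s k))^-1)%g.
Proof. by rewrite -addnn alt_cat cox_word_cat cox_wordV rev_alt. Qed.

Lemma cox_braid s t :
  wd (alt s t (cox_mat s t)) = wd (alt t s (cox_mat s t)).
Proof.
have := cox_rel s t; rewrite cox_word_alt_double => /mulg1_eq.
by move/(congr1 (@monoid.inv C)); rewrite !invgK.
Qed.

(** If s t = 1, then m_st divides 1 by [cox_order], hence s = t. *)
Lemma cox_gen_inj : injective g.
Proof.
move=> s t e; apply/eqP; apply: contraT => st.
have := @cox_order C s t 1 st isT; rewrite /= !cox_word_cons -e cox_genKl.
rewrite cox_word_nil dvdn1 cox_mat_diag (negbTE st) andbF.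
by move=> /(_ erefl).
Qed.

Lemma reducedPn u v : wd u = wd v -> (size v < size u)%N -> ~~ reduced u.
Proof. by move=> e vu; rewrite /reduced e; have := len_word v; lia. Qed.

Lemma reduced_catl u v : reduced (u ++ v) -> reduced u.
Proof.
rewrite /reduced cox_word_cat size_cat; have := lenM (wd u) (wd v).
by have := len_word u; have := len_word v; lia.
Qed.

(* If t shortens a reduced word s t s .. in the dihedral group, the exchanged
   letter is the last one. *)
Lemma alt_exchange s t k i : s != t -> reduced (alt s t k) -> (i < k)%N ->
  (g t * wd (alt s t k))%g = wd (del i (alt s t k)) ->
  wd (alt s t k) = wd (alt t s k).
Proof.
move=> st rk ik e; have k1 : (1 < k)%N.
  case: k rk ik e => [|[|k]] // _; case: i => // _ /=.
  rewrite cox_word1 /del /= cox_word_nil => /mulg1_eq; rewrite cox_genV.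
  by move/cox_gen_inj => ts; rewrite ts eqxx in st.
(* Deleting the first letter would force t = s. *)
have [i0|i0] := posnP i.
  move: e; rewrite i0; case: k rk ik k1 => // k _ _ _.
  rewrite altS /del /= drop0 cox_word_cons => e'.
  have : (g t * g s * wd (alt t s k))%g = (1 * wd (alt t s k))%g.
    by rewrite -mulgA e' mul1g.
  move/mulIg/mulg1_eq; rewrite cox_genV => /cox_gen_inj ts.
  by rewrite ts eqxx in st.
have [ik1|ik1] := eqVneq i.+1 k.
  have {}ik1 : k = i.+1 by [].
  move: e; rewrite ik1 {1}alt_rcons [in X in del _ X]alt_rcons /del.
  rewrite drop_oversize ?size_rcons ?size_alt // cats0 -cats1 take_cat size_alt.
  rewrite ltnn subnn take0 cats0 => e'.
  by rewrite [in RHS]altS cox_word_cons -e' cats1 -alt_rcons cox_genKl.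
(* An inner letter has equal neighbours, which cancel once it is deleted; the length would drop by
   at least 3, but t changes it by 1 only. *)
exfalso; have {i0 ik ik1} [j [r [ij kE]]] : exists j r, i = j.+1 /\ k = (j + r.+3)%N.
  by exists i.-1, (k - i.-1 - 3)%N; lia.
have := len_genMP t (wd (alt s t k)); rewrite (eqP rk) size_alt.
suff : (len (g t * wd (alt s t k))%g <= j + r)%N by lia.
rewrite e kE ij alt_cat del_cat size_alt ltnNge leqnSn /= subSnn.
have h a b : (len (wd (alt s t j ++ del 1 (alt a b r.+3))) <= j + r)%N.
  rewrite /del /= !cox_word_cat !cox_word_cons cox_genKl.
  rewrite -cox_word_cat (leq_trans (len_word _)) // size_cat size_alt.
  by rewrite -/(alt b a r) size_alt.
by case: (odd j); exact: h.
Qed.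

(** m_st divides k by [cox_order]. If k were larger, a braid move on the first m_st letters would
    create two equal neighbours, against reducedness. *)
Lemma alt_order s t k : s != t -> (0 < k)%N -> reduced (alt s t k) ->
  wd (alt s t k) = wd (alt t s k) -> k = cox_mat s t /\ (0 < cox_mat s t)%N.
Proof.
move=> st k0 rk e; have := cox_order st k0.
rewrite cox_word_alt_double e mulgV => /(_ erefl)/andP[m0 /dvdn_leq mk].
split=> //; apply/eqP; rewrite eqn_leq mk // andbT leqNgt; apply/negP => mk'.
have [m mE] : exists m, cox_mat s t = m.+1 by exists (cox_mat s t).-1; lia.
have [r kE] : exists r, k = (cox_mat s t + r.+1)%N.
  by exists (k - cox_mat s t).-1; lia.
pose c := if odd m.+1 then t else s.
have := rk; rewrite kE alt_cat.
have -> : (if odd (cox_mat s t) then alt t s r.+1 else alt s t r.+1) =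
  c :: (if odd m.+1 then alt s t r else alt t s r).
  by rewrite mE /c; case: (odd m.+1).
set v := (X in c :: X).
have vr : size v = r by rewrite /v; case: ifP => _; rewrite size_alt.
apply/negP; apply: (@reducedPn _ (alt t s m ++ v)); last first.
  by rewrite !size_cat !size_alt mE /= vr; lia.
rewrite !cox_word_cat cox_braid mE alt_rcons cox_word_rcons cox_word_cons.
have -> : (if odd m then s else t) = c by rewrite /c /=; case: (odd m).
by rewrite -mulgA cox_genKl.
Qed.

(** Take a reduced word of x whose alternating prefix a b a .. in s and t is as long as possible. As
    b also shortens x, the exchange turns this prefix into b a b .., and [alt_order] gives its
    length. *)
Lemma two_descents s t x : s != t ->
  (len (g s * x)%g < len x)%N -> (len (g t * x)%g < len x)%N ->
  (0 < cox_mat s t)%N /\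
  exists v, reduced (alt s t (cox_mat s t) ++ v) /\
            wd (alt s t (cox_mat s t) ++ v) = x.
Proof.
move=> st sx tx.
pose P k := `[< exists a b v, [/\ (a, b) = (s, t) \/ (a, b) = (t, s),
  reduced (alt a b k ++ v) & wd (alt a b k ++ v) = x] >].
have ex : exists k, P k.
  exists 1%N; apply/asboolP; exists s, t, (redex (g s * x)%g); split; first by left.
    by rewrite /= reduced_cons redexP cox_word_redex cox_genKl.
  by rewrite /= cox_word_cons cox_word_redex cox_genKl.
have bd k : P k -> (k <= len x)%N.
  move=> /asboolP[a [b [v [_ /eqP r <-]]]].
  by rewrite r size_cat size_alt leq_addr.
have [k /asboolP[a [b [v [ab rv vx]]]] kmax] := ex_maxnP ex bd.
have k0 : (0 < k)%N.
  apply: kmax; apply/asboolP; exists s, t, (redex (g s * x)%g); split; first by left.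
    by rewrite /= reduced_cons redexP cox_word_redex cox_genKl.
  by rewrite /= cox_word_cons cox_word_redex cox_genKl.
have abN : a != b by case: ab => -[-> ->]; rewrite // eq_sym.
have bx : (len (g b * x)%g < len x)%N by case: ab => -[_ ->].
have wv : wd (alt a b k) = wd (alt b a k).
  have := bx; rewrite -vx cox_word_cat cox_mulA => /ltnW/exchange_cat[[i]|[i iv e]].
    by rewrite size_alt => ik; apply: alt_exchange => //; exact: reduced_catl rv.
  (* An exchange in the tail would put b in front and lengthen the alternating prefix. *)
  exfalso; suff /kmax : P k.+1 by rewrite ltnn.
  have wx : wd (alt b a k.+1 ++ del i v) = x.
    rewrite altS cat_cons cox_word_cons cox_word_cat -e -mulgA -cox_word_cat vx.
    exact: cox_genKl.
  apply/asboolP; exists b, a, (del i v); split=> //.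
    by case: ab => -[-> ->]; [right|left].
  rewrite /reduced wx -vx (eqP rv) (size_cat _ (del i v)) (size_del iv) size_cat.
  rewrite !size_alt.
  by move: iv; lia.
have [km m0] := alt_order abN k0 (reduced_catl rv) wv.
have mE : cox_mat a b = cox_mat s t by case: ab => -[-> ->]; rewrite // cox_mat_sym.
rewrite -mE -km k0; split=> //; exists v.
suff wE : wd (alt s t k) = wd (alt a b k).
  rewrite /reduced cox_word_cat wE -cox_word_cat vx; split=> //.
  by rewrite -vx (eqP rv) !size_cat !size_alt.
by move: wv; case: ab => -[-> ->] => [|->].
Qed.

(** If the first letters s and t differ, both are descents, and [two_descents] yields reduced words
    starting with the two sides of the braid relation; each given word shares its first letter with
    one of them. *)
Lemma matsumoto (T : Type) (op : cox_index C -> T -> T) :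
  (forall s t f, s != t -> (0 < cox_mat s t)%N ->
    foldr op f (alt s t (cox_mat s t)) = foldr op f (alt t s (cox_mat s t))) ->
  forall u v f, reduced u -> reduced v -> wd u = wd v ->
  foldr op f u = foldr op f v.
Proof.
move=> braid u; have [n] := ubnP (size u); elim: n u => // n IHn u un v f ru rv uv.
have szE : size u = size v by rewrite -(eqP ru) -(eqP rv) uv.
case: u v un ru rv uv szE => [|s u] [|t v] // un ru rv uv [szE].
have [st|st] := eqVneq s t.
  move: ru rv uv; rewrite -st !reduced_cons !cox_word_cons /=.
  by move=> /andP[ru _] /andP[rv _] /mulgI uv; rewrite (IHn u _ v).
have sd : (len (g s * wd (s :: u))%g < len (wd (s :: u)))%N.
  by rewrite (eqP ru) cox_word_cons cox_genKl /= ltnS len_word.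
have td : (len (g t * wd (s :: u))%g < len (wd (s :: u)))%N.
  by rewrite (eqP ru) uv cox_word_cons cox_genKl /= szE ltnS len_word.
have [m0 [v0 [r0 w0]]] := two_descents st sd td.
have [m mE] : exists m, cox_mat s t = m.+1 by exists (cox_mat s t).-1; lia.
have r0' : reduced (alt t s (cox_mat s t) ++ v0).
  move: r0; rewrite /reduced !cox_word_cat cox_braid !size_cat !size_alt //.
have w0' : wd (alt t s (cox_mat s t) ++ v0) = wd (t :: v).
  by rewrite -uv -w0 !cox_word_cat cox_braid.
transitivity (foldr op f (alt s t (cox_mat s t) ++ v0)).
  move: r0 w0 ru; rewrite mE altS cat_cons /= !reduced_cons !cox_word_cons.
  by move=> /andP[r0 _] /mulgI w0 /andP[ru _]; rewrite (IHn u _ (alt t s m ++ v0)).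
transitivity (foldr op f (alt t s (cox_mat s t) ++ v0)).
  by rewrite !foldr_cat braid.
move: r0' w0' rv; rewrite mE altS cat_cons /= !reduced_cons !cox_word_cons.
move=> /andP[r0' _] /mulgI w0' /andP[rv _]; rewrite -(IHn v _ (alt s t m ++ v0)) //.
by rewrite -szE.
Qed.

End Matsumoto.

(** * Double cosets *)

Section DoubleCosets.
Variable C : coxeter_system.
Implicit Types (s t : cox_index C) (x y z : C) (I J K : set (cox_index C)).

Local Notation g := (@cox_gen C).
Local Notation wd := (@cox_word C).
Local Notation len := (@cox_length C).

(** At x = [dcoset_min p] this is convertible to [left_redundancy I J p]. *)
Definition redundancy I J x : set (cox_index C) :=
  [set s | I s /\ exists2 t, J t & g s = (x * g t * x^-1)%g].

Definition min_double I J x := forall u v : C,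
  parabolic I u -> parabolic J v -> (len x <= len (u * x * v)%g)%N.

Lemma min_double_left I J x : min_double I J x -> min_left I x.
Proof.
by move=> mx u Iu; have := mx u 1%g Iu (@parabolic1 C J); rewrite mulg1.
Qed.

Lemma min_double_right I J x : min_double I J x -> min_right J x.
Proof.
by move=> mx v Jv; have := mx 1%g v (@parabolic1 C I) Jv; rewrite mul1g.
Qed.

(** The first letter s of z shortens x v. By minimality of x the exchange falls in v, so s x = x r
    with r in W_J; comparing lengths, r is a generator, hence s is in the redundancy. *)
Lemma kilmoyer I J x (z v : C) : min_double I J x ->
  parabolic I z -> parabolic J v -> (z * x)%g = (x * v)%g ->
  parabolic (redundancy I J x) z.
Proof.
move=> mx /parabolicP[w [+ <-]]; elim: w v => [|s w IHw] v.
  by move=> *; rewrite cox_word_nil; exact: parabolic1.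
rewrite reduced_cons => /andP[rw sw] /word_in_cons[Is wI] Jv e.
have mxl := min_double_left mx; have mxr := min_double_right mx.
have /parabolicP[b [rb bv bJ]] := Jv.
have e' : (g s * x * v)%g = (wd w * x)%g.
  by rewrite -mulgA -e cox_word_cons -mulgA cox_genKl.
have le : (len (g s * wd (redex x) * wd b)%g <= len (wd (redex x) * wd b)%g)%N.
  rewrite bv cox_word_redex e' -e (min_left_len mxl (parabolic_word wI)).
  have Isw : parabolic I (wd (s :: w)) by apply: parabolic_word; apply/word_in_cons.
  by rewrite (min_left_len mxl Isw) cox_word_cons leq_add2r ltnW.
have [[i ix ei]|[i ib]] := exchange_cat le.
  have := len_word (del i (redex x)); rewrite -ei size_del // cox_word_redex.
  by rewrite (min_left_len mxl (parabolic_gen Is)) len_gen /cox_length; lia.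
rewrite cox_word_redex bv; set v' := wd _ => ev.
have Jv' : parabolic J v' by apply: parabolic_word => t /mem_del /bJ.
have Jr : parabolic J (v' * v^-1)%g by apply: parabolicM => //; exact: parabolicV.
have er : (g s * x)%g = (x * (v' * v^-1))%g by rewrite mulgA -ev mulgK.
have lr : len (v' * v^-1)%g = 1%N.
  have := min_right_len mxr Jr; rewrite -er (min_left_len mxl (parabolic_gen Is)).
  by rewrite len_gen; lia.
have [t Jt tE] := parabolic_len1 Jr lr.
rewrite cox_word_cons; apply: parabolicM; last first.
  by apply: (IHw v') => //; rewrite -e' ev.
apply: parabolic_gen; split=> //; exists t => //.
by rewrite -tE -er mulgK.
Qed.

(** For u = s w, an exchange in w contradicts reducedness and one in x contradicts minimality. An
    exchange in v puts r = w^-1 s w in W_K by [kilmoyer], although u r = w is shorter than u. *)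
Lemma min_double_len I J x (u v : C) : min_double I J x ->
  parabolic I u -> parabolic J v -> min_right (redundancy I J x) u ->
  len (u * x * v)%g = (len u + len x + len v)%N.
Proof.
move=> mx /parabolicP[w [+ <-]]; elim: w => [|s w IHw].
  move=> _ _ Jv _; rewrite cox_word_nil mul1g len1.
  exact: min_right_len (min_double_right mx) Jv.
move=> rsw /word_in_cons[Is wI] Jv mu.
move: (rsw); rewrite reduced_cons => /andP[rw sw].
have mw : min_right (redundancy I J x) (wd w).
  move=> k Kk; have := mu _ Kk; rewrite cox_word_cons -cox_mulA.
  move: sw; have := lenM (g s) (wd w); rewrite len_gen.
  by have := lenM (g s) (wd w * k)%g; rewrite len_gen; lia.
have {IHw} lw := IHw rw wI Jv mw.
have lsw : len (wd (s :: w)) = (len (wd w)).+1 by rewrite (eqP rsw) (eqP rw).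
have lsw_ind : (len (wd w * x * v)%g < len (g s * (wd w * x * v))%g)%N ->
    len (wd (s :: w) * x * v)%g = (len (wd (s :: w)) + len x + len v)%N.
  rewrite lsw cox_word_cons -!cox_mulA; move: lw; rewrite -!cox_mulA.
  by case: (len_genMP s (wd w * (x * v))%g); lia.
have [//|le] := ltnP (len (wd w * x * v)%g) (len (g s * (wd w * x * v))%g).
exfalso; have /parabolicP[b [rb bv bJ]] := Jv.
have Iw : parabolic I (wd w) := parabolic_word wI.
rewrite -bv -{1 2}(cox_word_redex x) !cox_mulA in le.
have [[i iw ei]|[i ix]|[i ib]] := exchange_cat3 le.
- have := len_word (del i w); rewrite -ei size_del //; have := eqP rw; lia.
- rewrite cox_word_redex => ei.
  have : (len x <= len (((wd w)^-1 * (g s * wd w)) * x * 1)%g)%N.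
    apply: mx; last exact: parabolic1.
    by apply: parabolicM; [exact: parabolicV | apply: parabolicM => //];
      exact: parabolic_gen.
  rewrite mulg1 -mulgA ei mulKg.
  have := len_word (del i (redex x)); rewrite size_del // => a b'.
  by move: (leq_trans b' a) ix; rewrite /cox_length; lia.
rewrite cox_word_redex bv; set v' := wd (del i b) => ev.
have Jv' : parabolic J v' by apply: parabolic_word => t /mem_del /bJ.
set r := ((wd w)^-1 * (g s * wd w))%g.
have Ir : parabolic I r.
  by apply: parabolicM; [exact: parabolicV | apply: parabolicM => //];
      exact: parabolic_gen.
have Kr : parabolic (redundancy I J x) r.
  apply: (@kilmoyer _ _ _ _ (v' * v^-1)%g mx Ir).
    by apply: parabolicM => //; exact: parabolicV.
  apply: (mulIg v); rewrite !mulgA mulgVK.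
  have -> : (r * x * v = (wd w)^-1 * (g s * wd w * x * v))%g by rewrite /r !mulgA.
  by rewrite ev -!mulgA mulKg.
have := min_right_len mu Kr; rewrite lsw /r cox_word_cons.
by rewrite -mulgA mulVKg cox_genKl; lia.
Qed.

(** Steps of [bruhat] multiply on the right; s y is y times the reflection y^-1 s y. *)
Lemma bruhat_genl s x y : bruhat x y -> (len y < len (g s * y)%g)%N ->
  bruhat x (g s * y)%g.
Proof.
move=> xy; have -> : (g s * y = y * (y^-1 * g s * y))%g by rewrite !mulgA mulgV mul1g.
by apply: BruhatStep => //; exists y^-1%g, s; rewrite invgK.
Qed.

Lemma bruhat_genr s x y : bruhat x y -> (len y < len (y * g s)%g)%N ->
  bruhat x (y * g s)%g.
Proof.
move=> xy; apply: BruhatStep => //; exists 1%g, s.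
by rewrite mul1g invg1 mulg1.
Qed.

Lemma bruhat_mul x (u v : C) :
  len (u * x * v)%g = (len u + len x + len v)%N -> bruhat x (u * x * v)%g.
Proof.
rewrite -(cox_word_redex u) -(cox_word_redex v).
move: (redex u) (redexP u) (redex v) (redexP v) => {u v}.
elim=> [_ v|s u IHu rsu v rv l].
  rewrite cox_word_nil len1 add0n mul1g; elim/last_ind: v => [|v s IHv] rv l.
    by rewrite cox_word_nil mulg1; exact: BruhatRefl.
  have rv' : reduced v by move: rv; rewrite -cats1 => /reduced_catl.
  move: l; rewrite (eqP rv) size_rcons cox_word_rcons cox_mulA => l.
  have := lenM (x * wd v)%g (g s); have := lenM x (wd v).
  rewrite len_gen l (eqP rv') => l1 l2.
  by apply: bruhat_genr; [apply: IHv => //; rewrite (eqP rv') | rewrite l]; lia.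
move: (rsu); rewrite reduced_cons => /andP[ru _].
move: l; rewrite (eqP rsu) cox_word_cons -!cox_mulA => l.
have := lenM (g s) (wd u * (x * wd v))%g; have := lenM (wd u) (x * wd v)%g.
have := lenM x (wd v); rewrite len_gen l (eqP ru) /= => l1 l2 l3.
apply: bruhat_genl; last by rewrite l /=; lia.
by rewrite cox_mulA; apply: IHu => //; rewrite -cox_mulA (eqP ru); lia.
Qed.

Lemma bruhat_len x y : bruhat x y -> (len x <= len y)%N.
Proof. by elim=> // z t _ xz _ zt; apply: leq_trans xz (ltnW zt). Qed.

Lemma redundancy_sub I J x : redundancy I J x `<=` I.
Proof. by move=> s []. Qed.

Lemma redundancy_conj I J x (k : C) : parabolic (redundancy I J x) k ->
  parabolic J (x^-1 * k * x)%g.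
Proof.
move=> /parabolicP[w [_ <-]]; elim: w => [|s w IHw] wK.
  by rewrite cox_word_nil mulg1 mulVg; exact: parabolic1.
move: wK => /word_in_cons[[_ [t Jt tE]] /IHw Jw].
have -> : (x^-1 * wd (s :: w) * x = g t * (x^-1 * wd w * x))%g.
  by rewrite cox_word_cons tE !mulgA mulVg mul1g.
by apply: parabolicM => //; exact: parabolic_gen.
Qed.

(** A shortest x in p is Bruhat minimal: write y = u x v and shift a factor in W_K from u through x
    into v, so that u becomes minimal and the lengths add up. Hence the choice in [dcoset_min] does
    not fall back on its default. *)
Lemma dcoset_minP I J (p : set C) : is_dcoset I J p ->
  p (dcoset_min p) /\ min_double I J (dcoset_min p).
Proof.
move=> [x0 pE].
have pP y : p y <-> exists u v, [/\ parabolic I u, parabolic J v & y = (u * x0 * v)%g].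
  rewrite pE; split=> [[u Iu [v Jv <-]]|[u [v [Iu Jv ->]]]]; first by exists u, v.
  by exists u => //; exists v.
have pM y u v : p y -> parabolic I u -> parabolic J v -> p (u * y * v)%g.
  move=> /pP[a [b [Ia Jb ->]]] Iu Jv; apply/pP; exists (u * a)%g, (b * v)%g.
  by split; [exact: parabolicM | exact: parabolicM | rewrite !mulgA].
suff : p (dcoset_min p) /\ forall y, p y -> bruhat (dcoset_min p) y.
  move=> [pm bm]; split=> // u v Iu Jv; apply: bruhat_len; apply: bm.
  exact: pM.
have ex : exists n, `[< exists2 x, p x & len x = n >].
  exists (len x0); apply/asboolP; exists x0 => //; apply/pP; exists 1%g, 1%g.
  by split; rewrite ?mul1g ?mulg1; try exact: parabolic1.
have [n /asboolP[x px xn] nmin] := ex_minnP ex.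
have mx : min_double I J x.
  move=> u v Iu Jv; rewrite xn; apply: nmin; apply/asboolP.
  by exists (u * x * v)%g => //; exact: pM.
apply: (@xgetPex _ 1%g [set x | p x /\ forall y, p y -> bruhat x y]).
exists x; split=> // y py.
have [u [v [Iu Jv yE]]] : exists u v,
    [/\ parabolic I u, parabolic J v & y = (u * x * v)%g].
  have /pP[a [b [Ia Jb ->]]] := py; have /pP[a' [b' [Ia' Jb' xE]]] := px.
  exists (a * a'^-1)%g, (b'^-1 * b)%g; split.
  - by apply: parabolicM => //; exact: parabolicV.
  - by apply: parabolicM => //; exact: parabolicV.
  - by rewrite xE !mulgA mulgVK mulgK.
have [k Kk mk] := min_right_ex (redundancy I J x) u.
have Iuk : parabolic I (u * k)%g.
  by apply: parabolicM => //; exact: parabolicS (@redundancy_sub _ _ _) _ Kk.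
have Jkv : parabolic J ((x^-1 * k * x)^-1 * v)%g.
  by apply: parabolicM => //; apply: parabolicV; exact: redundancy_conj Kk.
have -> : y = (u * k * x * ((x^-1 * k * x)^-1 * v))%g.
  by rewrite yE !invgM invgK !mulgA !mulgK.
exact: bruhat_mul (min_double_len mx Iuk Jkv mk).
Qed.

End DoubleCosets.

(** * Demazure operators *)

Lemma rank_ind n (r : 'I_n -> nat) (P : 'I_n -> Prop) :
  (forall i, (forall j, (r i < r j)%N -> P j) -> P i) -> forall i, P i.
Proof.
move=> IH i; pose N := (\max_j r j)%N.
have rN j : (r j <= N)%N by exact: leq_bigmax.
have [m] := ubnP (N - r i); elim: m i => // m IHm i im.
apply: IH => j ij; apply: IHm; have := rN j; lia.
Qed.

(** Back substitution as a fixed point: a row of rank r is stable after N - r iterations, since it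
    depends only on rows of higher rank. *)
Lemma triangular_family (R : pzRingType) n (r : 'I_n -> nat) (d : 'I_n -> R)
    (G : 'I_n -> 'I_n -> R) :
  exists E, forall i, E i = d i - \sum_(j < n | (r i < r j)%N) G j i * E j.
Proof.
pose F E i := d i - \sum_(j < n | (r i < r j)%N) G j i * E j.
pose N := (\max_j r j).+1.
have rN j : (r j < N)%N by rewrite ltnS; exact: leq_bigmax.
suff st m i : (N - r i <= m)%N -> iter m.+1 F d i = iter m F d i.
  by exists (iter N F d) => i; rewrite -[LHS](st N i) ?leq_subr.
elim: m i => [|m IHm] i im; first by have := rN i; move: im; lia.
rewrite iterS [RHS]/= /F; congr (_ - _); apply: eq_bigr => j ij.
by congr (_ * _); apply: IHm; have := rN j; lia.
Qed.

Lemma finitaryS (C : coxeter_system) (I J : set (cox_index C)) :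
  I `<=` J -> finitary J -> finitary I.
Proof. by move=> IJ; apply: sub_finite_set; exact: parabolicS. Qed.

(* [R] stands for Sym(V), [D] for the Demazure operators and [hom n] for the
   homogeneous elements of degree n; the hypotheses are all that is used of
   them. *)
Section NilHecke.
Variables (k : fieldType) (C : coxeter_system) (V : realization k C).
Variables (R : comAlgType k) (iota : {linear V -> R}) (act : C -> R -> R).
Implicit Types (s t : cox_index C) (u : seq (cox_index C)) (x y : C).
Implicit Types (f h : R) (v : V) (a : k).

Local Notation g := (@cox_gen C).
Local Notation wd := (@cox_word C).
Local Notation len := (@cox_length C).
Local Notation al s := (iota (Defs.root V s)).
Local Notation pair s v := (coroot V s v : k).

Hypothesis R_ind : forall P : R -> Prop, P 1 ->
  (forall a f h, P f -> P h -> P (a *: f + h)) ->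
  (forall v f, P f -> P (iota v * f)) -> forall f, P f.
Hypothesis act1 : forall x, act x 1 = 1.
Hypothesis actP : forall x a f h, act x (a *: f + h) = a *: act x f + act x h.
Hypothesis actM : forall x f h, act x (f * h) = act x f * act x h.
Hypothesis act_iota : forall x v, act x (iota v) = iota (ract V x v).
Hypothesis root_reg : forall s f h, f * al s = h * al s -> f = h.

Lemma act_mulg x y f : act (x * y)%g f = act x (act y f).
Proof.
apply: (R_ind (P := fun f => act (x * y)%g f = act x (act y f))).
- by rewrite !act1.
- by move=> a f1 f2 IH1 IH2; rewrite !actP IH1 IH2.
- by move=> v f1 IH; rewrite !actM IH !act_iota ractM.
Qed.

Lemma act_one f : act 1%g f = f.
Proof.
apply: (R_ind (P := fun f => act 1%g f = f)) => [|a f1 f2 IH1 IH2|v f1 IH].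
- exact: act1.
- by rewrite actP IH1 IH2.
- by rewrite actM IH act_iota ract1.
Qed.

Lemma act_gen_iota s v : act (g s) (iota v) = iota v - pair s v *: al s.
Proof. by rewrite act_iota ract_gen linearB linearZ. Qed.

Lemma act_root s : act (g s) (al s) = - al s.
Proof.
by rewrite act_gen_iota coroot_root scaler_nat mulr2n opprD addrA subrr sub0r.
Qed.

(** The witness for v f is the twisted Leibniz rule. This precedes [D] because it shows that an
    operator defined by choice is a true quotient. *)
Lemma divided_difference_ex s f : exists q, q * al s = f - act (g s) f.
Proof.
move: f; apply: R_ind => [|a f h [q qE] [r rE]|v f [q qE]].
- by exists 0; rewrite mul0r act1 subrr.
- exists (a *: q + r); rewrite mulrDl -scalerAl qE rE actP.
  by rewrite scalerBr opprD addrACA.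
- exists (pair s v *: f + act (g s) (iota v) * q).
  rewrite mulrDl -[_ * q * _]mulrA qE actM act_gen_iota -scalerAl.
  rewrite [f * al s]mulrC scalerAl; set w := _ *: al s; ring.
Qed.

(** * Demazure operators of simple reflections and their braid relations *)

Variable D : cox_index C -> R -> R.
Hypothesis DE : forall s f, D s f * al s = f - act (g s) f.

Lemma D_uniq s f q : q * al s = f - act (g s) f -> D s f = q.
Proof. by move=> e; apply: (@root_reg s); rewrite DE e. Qed.

Lemma D_linear s a f h : D s (a *: f + h) = a *: D s f + D s h.
Proof.
apply: D_uniq; rewrite mulrDl -scalerAl !DE actP.
by rewrite scalerBr opprD addrACA.
Qed.

Lemma D_mul s f h : D s (f * h) = D s f * h + act (g s) f * D s h.
Proof.
apply: D_uniq; rewrite mulrDl [D s f * h * _]mulrAC -[act _ _ * _ * _]mulrA.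
by rewrite !DE actM mulrBl mulrBr addrA subrK.
Qed.

Lemma D_eq0 s f : D s f = 0 <-> act (g s) f = f.
Proof.
have e := DE s f; split=> [D0|sf].
  by move: e; rewrite D0 mul0r => /esym/eqP; rewrite subr_eq0 => /eqP.
by apply: D_uniq; rewrite sf mul0r subrr.
Qed.

(** Numerator f - s(f) and denominator alpha_s both change sign under s. *)
Lemma actD s f : act (g s) (D s f) = D s f.
Proof.
apply: (@root_reg s); apply: oppr_inj.
rewrite -mulrN -act_root -actM DE.
have -> : f - act (g s) f = -1 *: act (g s) f + f by rewrite scaleN1r addrC.
by rewrite actP -act_mulg cox_genK act_one !scaleN1r opprD opprK addrC.
Qed.

Lemma D_D s f : D s (D s f) = 0.
Proof. by apply/D_eq0; exact: actD. Qed.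

Lemma D_inv s f h : act (g s) f = f -> D s (f * h) = f * D s h.
Proof. by move=> sf; rewrite D_mul sf (D_eq0 s f).2 // mul0r add0r. Qed.

Lemma D_iotaM s v h :
  D s (iota v * h) = iota (ract V (g s) v) * D s h + pair s v *: h.
Proof.
rewrite D_mul act_iota addrC; congr (_ + _).
have -> : D s (iota v) = (pair s v)%:A.
  by apply: D_uniq; rewrite act_gen_iota mulr_algl opprB addrC subrK.
by rewrite mulr_algl.
Qed.

Lemma D1 s : D s 1 = 0.
Proof. by apply/D_eq0; rewrite act1. Qed.

Lemma D0 s : D s 0 = 0.
Proof. by have := D_linear s (-1) 0 0; rewrite scaler0 addr0 scaleN1r addNr. Qed.

Lemma D_scale s a f : D s (a *: f) = a *: D s f.
Proof. by have := D_linear s a f 0; rewrite D0 !addr0. Qed.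

Lemma D_add s f h : D s (f + h) = D s f + D s h.
Proof. by have := D_linear s 1 f h; rewrite !scale1r. Qed.

Local Notation Dw u := (foldr D ^~ u).

Lemma DwP u a f h : Dw u (a *: f + h) = a *: Dw u f + Dw u h.
Proof. by elim: u => //= s u ->; rewrite D_linear. Qed.

Lemma Dw0 u : Dw u 0 = 0.
Proof. by elim: u => //= s u ->; exact: D0. Qed.

Lemma Dw_inv u f h : (forall s, s \in u -> act (g s) f = f) ->
  Dw u (f * h) = f * Dw u h.
Proof.
elim: u => //= s u IHu uf; rewrite IHu => [|t tu]; last first.
  by apply: uf; rewrite inE tu orbT.
by rewrite D_inv // uf // inE eqxx.
Qed.

(** Expanding by [D_iotaM] drops one letter of the word. Dropping an inner letter makes two equal
    operators meet, which gives 0; only the first and the last letter contribute. *)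
Lemma Dw_alt_iotaM s t n v f :
  Dw (alt s t n.+2) (iota v * f) =
    iota (ract V (wd (alt s t n.+2)) v) * Dw (alt s t n.+2) f
    + (pair s (ract V (wd (alt t s n.+1)) v) *: Dw (alt t s n.+1) f
    + pair (if odd n then s else t) v *: Dw (alt s t n.+1) f).
Proof.
elim: n s t => [|n IHn] s t.
  rewrite /= D_iotaM addrC D_linear D_iotaM !cox_word_cons cox_word_nil !mulg1 ractM.
  by rewrite addrC addrA.
have DwS p q m h : Dw (alt p q m.+1) h = D p (Dw (alt q p m) h) by [].
rewrite DwS IHn !D_add D_iotaM !D_scale.
rewrite (DwS s t n) D_D scaler0 add0r -addrA -!DwS.
have -> : wd (alt s t n.+3) = (g s * wd (alt t s n.+2))%g by rewrite -cox_word_cons.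
by rewrite ractM /= if_neg.
Qed.

(** The two-coloured quantum numbers are matrix coefficients of alternating words. [H] carries two
    consecutive lengths and all pairs of letters, since the recursion has depth two and swaps the
    letters. *)
Lemma pair_alt s t v j : let x := - pair s (Defs.root V t) in
  let y := - pair t (Defs.root V s) in
  pair s (ract V (wd (alt t s j)) v) =
    two_color x y j.+1 * pair (if odd j then t else s) v
    + two_color x y j * pair (if odd j then s else t) v.
Proof.
have pE p q w : pair p (ract V (g q) w) = pair p w - pair q w * pair p (Defs.root V q).
  by rewrite ract_gen linearB linearZ.
have pEs p w : pair p (ract V (g p) w) = - pair p w.
  by rewrite pE coroot_root mulrC mulr_natl mulr2n opprD addrA subrr sub0r.
suff H j' s' t' : let x := - pair s' (Defs.root V t') in
    let y := - pair t' (Defs.root V s') in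
    let P i := pair s' (ract V (wd (alt t' s' i)) v) =
    two_color x y i.+1 * pair (if odd i then t' else s') v
    + two_color x y i * pair (if odd i then s' else t') v in
    P j' /\ P j'.+1 by case: (H j s t).
elim: j' s' t' => [|i IHi] s' t' /=.
  rewrite !cox_word_cons cox_word_nil !mulg1 ract1 pE; split; ring.
have [P0 P1] := IHi s' t'; split=> //; have [_ Q1] := IHi t' s'.
rewrite -/(alt s' t' i) -/(alt t' s' i).
rewrite !cox_word_cons !ractM pE pEs P0.
move: Q1; rewrite altS cox_word_cons ractM => ->.
rewrite !negbK /=.
case: (odd i); ring.
Qed.

Hypothesis V_balanced : balanced V.

(* Both sides satisfy D (v f) = w(v) D f + lower terms, with equal lower terms
   by [pair_alt], so that their difference is determined by its value 0 at 1. *)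
Lemma Dw_braid s t f : s != t -> (0 < cox_mat s t)%N ->
  Dw (alt s t (cox_mat s t)) f = Dw (alt t s (cox_mat s t)) f.
Proof.
move=> st m0; have ts : t != s by rewrite eq_sym.
have [n mE] : exists n, cox_mat s t = n.+2.
  have m1 : cox_mat s t != 1%N by rewrite cox_mat_diag.
  by exists (cox_mat s t - 2)%N; move: m1; lia.
have zero := real_quantum V st m0; have one := V_balanced st m0.
have zero' := real_quantum V ts; have one' := V_balanced ts.
rewrite (cox_mat_sym t s) in zero' one'; move: (zero' m0) (one' m0) => {}zero' {}one'.
have braid := cox_braid s t.
rewrite mE -[n.+2.-1]/n.+1 in zero one zero' one' braid *.
move: f; apply: R_ind => [|a f h IHf IHh|v f IHf].
- have D11 p q : Dw (alt p q n.+2) 1 = 0.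
    by rewrite alt_rcons foldr_rcons D1 Dw0.
  by rewrite !D11.
- by rewrite !DwP IHf IHh.
rewrite !Dw_alt_iotaM IHf braid; congr (_ + _).
have := pair_alt s t v n.+1; have := pair_alt t s v n.+1; cbv zeta.
rewrite zero one zero' one' !mul0r !mul1r !add0r => -> ->.
by rewrite addrC [odd n.+1]/= !if_neg.
Qed.

(** * Demazure operators of group elements *)

Definition dem x f : R := foldr D f (redex x).

(** For Sym(V), [dem] and [inv] unfold to [demazure] and [invariants], so the abstract results
    transfer by conversion. *)
Definition inv (I : set (cox_index C)) f := forall x : C, parabolic I x -> act x f = f.

Lemma inv_gens (I : set (cox_index C)) f :
  (forall s, I s -> act (g s) f = f) -> inv I f.
Proof.
move=> fI x /parabolicP[u [_ <- uI]]; elim: u uI => [|s u IHu].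
  by rewrite cox_word_nil act_one.
by move=> /word_in_cons[Is /IHu e]; rewrite cox_word_cons act_mulg e fI.
Qed.

Lemma invP (I : set (cox_index C)) a f h : inv I f -> inv I h -> inv I (a *: f + h).
Proof. by move=> fI hI x Ix; rewrite actP fI // hI. Qed.

Lemma inv_mul (I : set (cox_index C)) f h : inv I f -> inv I h -> inv I (f * h).
Proof. by move=> fI hI x Ix; rewrite actM fI // hI. Qed.

Lemma act0 x : act x 0 = 0.
Proof. by have := actP x (-1) 1 1; rewrite scaleN1r addNr scaleN1r addNr. Qed.

Lemma inv_sum (I : set (cox_index C)) n (P : pred 'I_n) (F : 'I_n -> R) :
  (forall i, P i -> inv I (F i)) -> inv I (\sum_(i < n | P i) F i).
Proof.
move=> FI; apply: (big_ind (fun f => inv I f)) => [x _|f h fI hI|i].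
- exact: act0.
- by have := invP 1 fI hI; rewrite scale1r.
- exact: FI.
Qed.

Lemma inv_sub (I : set (cox_index C)) f h : inv I f -> inv I h -> inv I (f - h).
Proof. by move=> fI hI; have := invP (-1) hI fI; rewrite scaleN1r addrC. Qed.

Lemma dem_word u f : reduced u -> dem (wd u) f = Dw u f.
Proof.
move=> ru; apply: matsumoto => //; last by rewrite cox_word_redex.
  by move=> s t h; exact: Dw_braid.
exact: redexP.
Qed.

Lemma demP x a f h : dem x (a *: f + h) = a *: dem x f + dem x h.
Proof. exact: DwP. Qed.

Lemma dem0 x : dem x 0 = 0.
Proof. exact: Dw0. Qed.

Lemma demD x f h : dem x (f + h) = dem x f + dem x h.
Proof. by have := demP x 1 f h; rewrite !scale1r. Qed.

Lemma demB x f h : dem x (f - h) = dem x f - dem x h.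
Proof. by have := demP x (-1) h f; rewrite !scaleN1r ![- _ + _]addrC. Qed.

Lemma dem_sum x n (P : pred 'I_n) (F : 'I_n -> R) :
  dem x (\sum_(i < n | P i) F i) = \sum_(i < n | P i) dem x (F i).
Proof. by apply: (big_morph (dem x)) => [f h|]; [exact: demD | exact: dem0]. Qed.

Lemma dem_one f : dem 1%g f = f.
Proof. by rewrite /dem (size0nil (len1 C)). Qed.

Lemma dem_gen s f : dem (g s) f = D s f.
Proof. by rewrite -cox_word1 dem_word // /reduced cox_word1 len_gen. Qed.

Lemma dem_mul x y f : len (x * y)%g = (len x + len y)%N ->
  dem (x * y)%g f = dem x (dem y f).
Proof.
move=> l; transitivity (dem (wd (redex x ++ redex y)) f).
  by rewrite cox_word_cat !cox_word_redex.
rewrite dem_word ?foldr_cat //.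
by rewrite /reduced cox_word_cat !cox_word_redex l size_cat.
Qed.

Lemma D_dem0 s x f : (len (g s * x)%g < len x)%N -> D s (dem x f) = 0.
Proof.
move=> lt; have e : x = (g s * (g s * x))%g by rewrite cox_genKl.
rewrite e dem_mul ?dem_gen ?D_D // -e len_gen.
by case: (len_genMP s x) => l; move: lt; rewrite ?l; lia.
Qed.

(** At the first letter of x, read from the right, where the lengths fail to add up, that letter is
    already a descent of the product to its right, and [D_dem0] applies. *)
Lemma dem_mul0 x y f : len (x * y)%g != (len x + len y)%N -> dem x (dem y f) = 0.
Proof.
rewrite {2}/dem -/(dem y f) {1}/dem -{1}(cox_word_redex x) /cox_length -/(len y).
rewrite -/(len (wd (redex x) * y)%g); move: (redex x) (redexP x).
elim=> [|s u IHu]; first by rewrite cox_word_nil mul1g add0n eqxx.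
rewrite reduced_cons => /andP[ru _]; rewrite cox_word_cons -cox_mulA => l.
have [e|ne] := eqVneq (len (wd u * y)%g) (size u + len y)%N; last first.
  by rewrite /= IHu // D0.
rewrite /= -dem_word // -dem_mul ?(eqP ru) // D_dem0 //.
move: l; rewrite /=; case: (len_genMP s (wd u * y)%g) => -> //.
by rewrite e addSn eqxx.
Qed.

Lemma dem_inv (I : set (cox_index C)) x f h : inv I f -> parabolic I x ->
  dem x (f * h) = f * dem x h.
Proof.
move=> fI /parabolicP[u [ru <- uI]]; rewrite !dem_word // Dw_inv // => s su.
by apply: fI; apply: parabolic_gen; exact: uI.
Qed.

Lemma dem_image_inv (I : set (cox_index C)) x f :
  (forall s, I s -> (len (g s * x)%g < len x)%N) -> inv I (dem x f).
Proof.
by move=> Ix; apply: inv_gens => s Is; apply/D_eq0/D_dem0/Ix.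
Qed.

Lemma dem_longest_inv (I : set (cox_index C)) f : finitary I ->
  inv I (dem (longest I) f).
Proof. by move=> fI; apply: dem_image_inv => s; exact: longest_descent. Qed.

(** The operator of w_I factors through d_s, and d_s(f d_s(r)) = d_s(f) d_s(r) = d_s(d_s(f) r). *)
Lemma dem_adjoint (I : set (cox_index C)) (b : C) f h : finitary I -> parabolic I b ->
  dem (longest I) (f * dem b h) = dem (longest I) (dem b^-1%g f * h).
Proof.
move=> fI /parabolicP[u [ru <- uI]].
rewrite cox_wordV !dem_word //; last first.
  by rewrite /reduced -cox_wordV lenV size_rev.
elim: u {ru} uI f => [|s u IHu] //= /word_in_cons[Is uI] f.
rewrite rev_cons foldr_rcons -IHu //; set r := Dw u h.
have l : len (longest I) = (len (longest I * g s)%g + len (g s))%N.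
  by have := longest_right fI (parabolic_gen Is); rewrite cox_genV.
have wD q : dem (longest I) q = dem (longest I * g s)%g (D s q).
  by rewrite -dem_gen -dem_mul cox_genKr.
rewrite !wD; congr (dem _ _).
by rewrite [f * _]mulrC !D_inv ?actD // mulrC.
Qed.

(** * The grading *)

Variable hom : nat -> R -> Prop.
Hypothesis hom0 : forall n, hom n 0.
Hypothesis hom1 : hom 0%N 1.
Hypothesis hom_iota : forall v, hom 1%N (iota v).
Hypothesis homP : forall n a f h, hom n f -> hom n h -> hom n (a *: f + h).
Hypothesis homM : forall m n f h, hom m f -> hom n h -> hom (m + n)%N (f * h).
Hypothesis hom_ind : forall Q : nat -> R -> Prop, Q 0%N 1 ->
  (forall n a f h, Q n f -> Q n h -> Q n (a *: f + h)) ->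
  (forall n v f, Q n f -> Q n.+1 (iota v * f)) ->
  forall n f, hom n f -> Q n f.

(** The predecessor is truncated at 0, so the vanishing in degree 0 is stated separately. *)
Lemma hom_D s n f : hom n f -> hom n.-1 (D s f) /\ (n = 0%N -> D s f = 0).
Proof.
move: n f; suff H n f : hom n f ->
    [/\ hom n f, hom n.-1 (D s f) & n = 0%N -> D s f = 0].
  by move=> n f /H[].
move: n f; apply: hom_ind => [|n a f h [f0 f1 f2] [h0 h1 h2]|n v f [f0 f1 f2]].
- by rewrite D1.
- rewrite D_linear; split; [exact: homP | exact: homP | move=> n0].
  by rewrite f2 // h2 // scaler0 addr0.
- rewrite D_iotaM; split=> //; first exact: (homM (hom_iota v) f0).
  rewrite addrC; apply: homP => //; case: n f1 {f0} f2 => [_ ->|n f1 _] //.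
    by rewrite mulr0.
  exact: (homM (hom_iota _) f1).
Qed.

Lemma homD s n f : hom n f -> hom n.-1 (D s f).
Proof. by case/(hom_D s). Qed.

Lemma homD0 s f : hom 0%N f -> D s f = 0.
Proof. by case/(hom_D s) => _; apply. Qed.

Lemma hom_word u n f : hom n f -> hom (n - size u)%N (Dw u f).
Proof.
elim: u => [|s u IHu] /=; first by rewrite subn0.
by move=> /IHu /(homD s); rewrite subnS.
Qed.

Lemma hom_dem x n f : hom n f -> hom (n - len x)%N (dem x f).
Proof. exact: hom_word. Qed.

Lemma hom_dem0 x n f : hom n f -> (n < len x)%N -> dem x f = 0.
Proof.
rewrite /dem /cox_length => fn; elim: (redex x) => [|s u IHu] //=.
rewrite ltnS leq_eqVlt => /orP[/eqP nu|/IHu->]; last exact: D0.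
by apply: homD0; have := hom_word u fn; rewrite nu subnn.
Qed.

(** The component of f of degree len x works: the other components contribute nothing in degree 0 to
    the image, which is 1. The maps [pi n] stand for the projections to the homogeneous
    components. *)
Lemma homogeneous_preimage (pi : nat -> {linear R -> R}) x f :
  (forall n h, hom n (pi n h)) -> (forall n h, hom n h -> pi n h = h) ->
  (forall m n h, m != n -> hom m h -> pi n h = 0) ->
  (forall h, exists N, forall M, (N <= M)%N -> h = \sum_(n < M) pi n h) ->
  dem x f = 1 -> exists2 e, hom (len x) e & dem x e = 1.
Proof.
move=> pi_hom pi_id pi_neq pi_sum f1; exists (pi (len x) f) => //.
have h1 n : pi 0%N (dem x (pi n f)) = if n == len x then dem x (pi n f) else 0.
  case: ltngtP => [lt|gt|->].
  - by rewrite (hom_dem0 (pi_hom n f) lt) linear0.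
  - by apply: pi_neq (hom_dem x (pi_hom n f)); rewrite -lt0n subn_gt0.
  - by apply: pi_id; have := hom_dem x (pi_hom (len x) f); rewrite subnn.
have [N fE] := pi_sum f; have := f1; rewrite {1}(fE (N + (len x).+1)%N) ?leq_addr //.
rewrite dem_sum => /(congr1 (pi 0%N)); rewrite linear_sum (pi_id _ _ hom1) => <-.
have lx : (len x < N + (len x).+1)%N by rewrite addnS ltnS leq_addl.
rewrite (bigD1 (Ordinal lx)) //= h1 eqxx big1 ?addr0 // => i.
by rewrite h1 -val_eqE /= => /negbTE->.
Qed.

Lemma hom_sum d n (P : pred 'I_n) (F : 'I_n -> R) :
  (forall i, P i -> hom d (F i)) -> hom d (\sum_(i < n | P i) F i).
Proof.
move=> Fd; apply: (big_ind (hom d)) => // f h fd hd.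
by have := homP 1 fd hd; rewrite scale1r.
Qed.

(** * The trace map and dual bases *)

Definition trace (K I : set (cox_index C)) f : R :=
  dem (longest I * (longest K)^-1)%g f.

Definition free_basis (K I : set (cox_index C)) n (c : 'I_n -> R) :=
  forall f, inv K f -> exists! a : {ffun 'I_n -> R},
    (forall i, inv I (a i)) /\ f = \sum_(i < n) a i * c i.

Section Trace.
Variables K I : set (cox_index C).
Hypothesis KI : K `<=` I.
Hypothesis fI : finitary I.

Let Iw : parabolic I (longest I) := (longestP fI).1.
Let Kw : parabolic I (longest K) :=
  parabolicS KI (longestP (finitaryS KI fI)).1.

Lemma trace_dem f : trace K I (dem (longest K) f) = dem (longest I) f.
Proof.
by rewrite /trace -dem_mul mulgVK // -(longest_right fI Kw).
Qed.

Lemma traceM f h : inv I f -> trace K I (f * h) = f * trace K I h.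
Proof.
move=> fI'; rewrite /trace (dem_inv _ fI') //; apply: parabolicM => //.
exact: parabolicV.
Qed.

Lemma dem_sub_one e : dem (longest I) e = 1 ->
  dem (longest K) (dem ((longest K)^-1 * longest I)%g e) = 1.
Proof. by move=> e1; rewrite -dem_mul mulVKg // -(longest_left fI Kw). Qed.

(** If d_{w_K} e' = 1, then h in R^K equals d_{w_K}(h e'), so its trace is d_{w_I}(h e'). *)
Lemma trace_inv e h : dem (longest I) e = 1 -> inv K h -> inv I (trace K I h).
Proof.
move=> /dem_sub_one e1 hK; rewrite -[h]mulr1 -e1 -(dem_inv _ hK) ?trace_dem.
  exact: dem_longest_inv.
exact: (longestP (finitaryS KI fI)).1.
Qed.

(** Duality makes tr(f d_i) the only possible coefficient of c_i; the difference between f and this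
    combination pairs to zero with every d_i. *)
Lemma dual_basis n (c d : 'I_n -> R) :
  (forall h, inv K h -> inv I (trace K I h)) ->
  (forall i, inv K (c i)) -> (forall i, inv K (d i)) ->
  (forall i j, trace K I (c i * d j) = (i == j)%:R) ->
  (forall h, inv K h -> (forall i, trace K I (h * d i) = 0) -> h = 0) ->
  free_basis K I c.
Proof.
move=> trI cK dK cd nd f fK.
have invKI h : inv I h -> inv K h by move=> hI x Kx; apply: hI; exact: parabolicS Kx.
have tr_sum (a : 'I_n -> R) j : (forall i, inv I (a i)) ->
    trace K I ((\sum_i a i * c i) * d j) = a j.
  move=> aI; rewrite mulr_suml [LHS]dem_sum.
  under eq_bigr => i _ do rewrite -mulrA [dem _ _](traceM _ (aI i)) cd.
  rewrite (bigD1 j) //= eqxx mulr1 big1 ?addr0 // => i /negbTE->.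
  exact: mulr0.
have trK i : inv I (trace K I (f * d i)) by apply: trI; exact: inv_mul.
exists [ffun i => trace K I (f * d i)]; split=> [|a [aI ->]]; last first.
  by apply/ffunP => i; rewrite ffunE tr_sum.
split=> [i|]; first by rewrite ffunE.
apply/eqP; rewrite -subr_eq0; apply/eqP; apply: nd.
  apply: inv_sub => //; apply: inv_sum => i _; apply: inv_mul => //.
  by apply: invKI; rewrite ffunE.
move=> j; rewrite mulrBl /trace demB -!/(trace K I _) tr_sum => [|i].
  by rewrite ffunE subrr.
by rewrite ffunE; exact: trK.
Qed.

End Trace.

(** Write x = (x u) u^-1 with lengths adding up: the last letter of u^-1 lies in K, and its operator
    is the first one applied to h. *)
Lemma dem_invK0 (K : set (cox_index C)) (x u : C) h : min_right K (x * u)%g ->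
  parabolic K u -> u != 1%g -> inv K h -> dem x h = 0.
Proof.
move=> mx Ku u1 hK; have Kv := parabolicV Ku.
have -> : x = (x * u * u^-1)%g by rewrite mulgK.
rewrite dem_mul ?(min_right_len mx Kv) //.
suff -> : dem u^-1%g h = 0 by rewrite dem0.
have /parabolicP[w [rw wE wK]] := Kv; rewrite -wE dem_word //.
elim/last_ind: w {rw} wE wK => [|w s _] wE wK.
  by move: u1; rewrite -[u]invgK -wE cox_word_nil invg1 eqxx.
rewrite foldr_rcons (D_eq0 s h).2 ?Dw0 //; apply: hK; apply: parabolic_gen.
by apply: wK; rewrite mem_rcons inE eqxx.
Qed.

(** Descending induction on the length of b: if longer elements of W_I give 0, then d_{b^-1} h is
    W_I-invariant and is recovered by pairing it with e. The case b = 1 is the claim. *)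
Lemma dem_nondegenerate (I : set (cox_index C)) e h : finitary I ->
  dem (longest I) e = 1 ->
  (forall b : C, parabolic I b -> dem (longest I) (dem b^-1%g h * e) = 0) -> h = 0.
Proof.
move=> fI e1 H; rewrite -[h]dem_one -(invg1 C).
move: (1%g : C) (@parabolic1 C I) => b.
have [_ mx] := longestP fI.
have [m] := ubnP (len (longest I) - len b); elim: m b => // m IHm b bm Ib.
have bI : inv I (dem b^-1%g h).
  apply: inv_gens => s Is; apply/D_eq0.
  have [lt|le] := ltnP (len (g s * b^-1)%g) (len b^-1%g); first exact: D_dem0.
  have l : len (g s * b^-1)%g = (len b^-1%g).+1.
    by case: (len_genMP s b^-1%g) le => ->; lia.
  rewrite -dem_gen -dem_mul ?len_gen //.
  have e2 : (g s * b^-1 = (b * g s)^-1)%g by rewrite invgM cox_genV.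
  have Ibs : parabolic I (b * g s)%g by apply: parabolicM => //; exact: parabolic_gen.
  rewrite e2; apply: IHm => //.
  by have := mx _ Ibs; move: l bm; rewrite e2 !lenV; lia.
by have := H b Ib; rewrite (dem_inv _ bI) ?e1 ?mulr1 //; case: (longestP fI).
Qed.

Theorem dual_bases_in_image (I J L : set (cox_index C)) (x : C) (e f : R) :
  I `<=` L -> J `<=` L -> finitary L -> parabolic L x -> min_double I J x ->
  hom (len (longest I)) e -> dem (longest I) e = 1 ->
  hom (len (longest L)) f -> dem (longest L) f = 1 ->
  let K := redundancy I J x in
  exists (n : nat) (c d : 'I_n -> R),
    [/\ forall i, inv K (c i) /\ exists m, hom m (c i),
        forall i, inv K (d i) /\ exists m, hom m (d i),
        free_basis K I c /\ free_basis K I d,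
        forall i j, trace K I (c i * d j) = (i == j)%:R
      & forall i, exists2 h, inv J h & dem x h = c i].
Proof.
move=> IL JL fL Lx mx he e1 hf f1 K.
have fI := finitaryS IL fL; have fJ := finitaryS JL fL.
have KI : K `<=` I := @redundancy_sub C I J x.
have fK := finitaryS KI fI.
have [Iw Imax] := longestP fI; have [Jw Jmax] := longestP fJ.
have [Kw Kmax] := longestP fK.
have KwI : parabolic I (longest K) := parabolicS KI Kw.
pose y := (x * longest J)%g.
have ly : len y = (len x + len (longest J))%N.
  exact: min_right_len (min_double_right mx) Jw.
have Ly : parabolic L y by apply: parabolicM => //; exact: parabolicS JL _ Jw.
have yK h : inv K (dem y h).
  (* For s in K, s x = x t with t in J, so s y = x (t w_J) is shorter than y. *)
  apply: dem_image_inv => s [Is [t Jt tE]].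
  have -> : (g s * y = x * (g t * longest J))%g by rewrite tE /y !mulgA mulgVK.
  have Jtw : parabolic J (g t * longest J)%g.
    by apply: parabolicM => //; exact: parabolic_gen.
  rewrite (min_right_len (min_double_right mx) Jtw) ly ltn_add2l.
  exact: longest_descent.
pose B := [set b : C | parabolic I b /\ min_right K b^-1%g].
have /finite_seqP[r0 rE] : finite_set B by apply: sub_finite_set fI => b [].
(* Repetitions are removed so that [b] is injective. *)
pose r := undup r0; pose n := size r.
pose b (i : 'I_n) : C := nth 1%g r i.
have bB i : B (b i) by rewrite rE /= -mem_undup mem_nth.
have b_inj : injective b.
  by move=> i j /eqP; rewrite nth_uniq ?undup_uniq // => /eqP/val_inj.
have b_surj w : B w -> exists i, b i = w.
  rewrite rE /= -mem_undup => wr.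
  have iw : (index w r < n)%N by rewrite index_mem.
  by exists (Ordinal iw); rewrite /b /= nth_index.
have Ib i : parabolic I (b i) := (bB i).1.
have Lb i : parabolic L (b i) := parabolicS IL (Ib i).
have lby i : len ((b i)^-1 * y)%g = (len (b i) + len y)%N.
  rewrite /y mulgA (min_double_len mx (parabolicV (Ib i)) Jw (bB i).2).
  by rewrite lenV ly addnA.
have Lby i : parabolic L ((b i)^-1 * y)%g.
  by apply: parabolicM => //; exact: parabolicV.
pose z i := (((b i)^-1 * y)^-1 * longest L)%g.
have lz i : len (longest L) = (len (b i) + len y + len (z i))%N.
  by rewrite (longest_left fL (Lby i)) lby.
pose c i := dem y (dem (z i) f).
pose d i := dem (longest K) (dem (b i) e).
have cK i : inv K (c i) := yK _.
have dK i : inv K (d i) by exact: dem_longest_inv.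
have hc i : hom (len (b i)) (c i).
  have := hom_dem y (hom_dem (z i) hf); rewrite (lz i).
  by rewrite addnK addnK.
have lbK i : (len (b i) + len (longest K) <= len (longest I))%N.
  have := min_right_len (bB i).2 Kw; rewrite lenV => <-.
  by apply: Imax; apply: parabolicM => //; exact: parabolicV.
pose m0 := (len (longest I) - len (longest K))%N.
have hd i : hom (m0 - len (b i))%N (d i).
  by have := hom_dem (longest K) (hom_dem (b i) he); rewrite subnAC.
have pairing h i : inv K h ->
    trace K I (h * d i) = dem (longest I) (dem (b i)^-1%g h * e).
  by move=> hK; rewrite -(dem_inv _ hK Kw) trace_dem // dem_adjoint.
have bc i j : dem (b i)^-1%g (c j) = dem ((b i)^-1 * y)%g (dem (z j) f).
  by rewrite dem_mul // lby lenV.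
have bc_lt i j : (len (b j) < len (b i))%N -> dem (b i)^-1%g (c j) = 0.
  by move=> lt; apply: hom_dem0 (hc j) _; rewrite lenV.
have bc_eq i j : len (b i) = len (b j) -> dem (b i)^-1%g (c j) = (i == j)%:R.
  move=> eij; rewrite bc; set q := ((b i)^-1 * y)%g.
  have lq : (len q + len (z j))%N = len (longest L) by rewrite /q lby eij -lz.
  have wq : (q * z i)%g = longest L by rewrite /q /z mulVKg.
  have [ij|ij] := eqVneq i j.
    by rewrite -dem_mul -ij ?wq ?f1 // ij lq.
  (* If the lengths add up, q z_j is as long as w_L, hence equal to it, which forces b_i = b_j;
     otherwise the composite vanishes. *)
  have [l|ne] := eqVneq (len (q * z j)%g) (len q + len (z j))%N; last exact: dem_mul0.
  have Lz : parabolic L (z j).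
    apply: parabolicM; first exact: parabolicV.
    by case: (longestP fL).
  have Lqz : parabolic L (q * z j)%g := parabolicM (Lby i) Lz.
  have := longest_left fL Lqz; rewrite l lq => /eqP.
  rewrite -{1}[len (longest L)]addn0 eqn_add2l => /eqP/esym/len0/mulg1_eq.
  rewrite invgK => qzE; exfalso; move: ij; apply/negP; rewrite negbK; apply/eqP.
  apply: b_inj; apply: invg_inj; apply: (mulIg y); rewrite -/q.
  by apply: (mulIg (z j)); rewrite qzE /z mulVKg.
pose G j i := trace K I (c j * d i).
have GI j i : inv I (G j i) by apply: (trace_inv KI fI e1); exact: inv_mul.
have [E EE] := @triangular_family R n (fun i => len (b i)) d G.
have invIK h : inv I h -> inv K h.
  by move=> hI w Kw'; apply: hI; exact: parabolicS Kw'.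
have EK i : inv K (E i).
  move: i; apply: (rank_ind (r := fun i => len (b i))) => i IH; rewrite EE.
  apply: inv_sub => //; apply: inv_sum => j ij; apply: inv_mul; last exact: IH.
  exact: invIK.
have hG j i : hom (len (b j) - len (b i))%N (G j i).
  rewrite /G pairing //.
  have := hom_dem (longest I) (homM (hom_dem (b i)^-1%g (hc j)) he).
  by rewrite addnK lenV.
have hE i : hom (m0 - len (b i))%N (E i).
  move: i; apply: (rank_ind (r := fun i => len (b i))) => i IH; rewrite EE.
  rewrite addrC -scaleN1r; apply: homP => //; apply: hom_sum => j ij.
  (* The degrees add up without truncation because [lbK] bounds the length of b_j by m0. *)
  have := homM (hG j i) (IH j ij); congr (hom _ _).
  by have := lbK j; move: ij; rewrite /m0; lia.
have tr_sum h i : trace K I (h * \sum_(j < n | (len (b i) < len (b j))%N) G j i * E j)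
    = \sum_(j < n | (len (b i) < len (b j))%N) G j i * trace K I (h * E j).
  rewrite mulr_sumr [LHS]dem_sum; apply: eq_bigr => j _.
  by rewrite mulrCA; exact: traceM.
have cE j i : trace K I (c j * E i) = (j == i)%:R.
  (* Descending induction on the length of b_i. If b_j is longer than b_i, the correction sum
     reduces to G j i and cancels the Gram entry; otherwise it vanishes and the Gram entry is
     already 0 or 1. *)
  move: i j; apply: (rank_ind (r := fun i => len (b i))) => i IH j.
  rewrite EE mulrBr [LHS]demB -!/(trace K I _) tr_sum -/(G j i).
  under eq_bigr => l il do rewrite IH //.
  have [ij|ji] := ltnP (len (b i)) (len (b j)).
    rewrite (bigD1 j) //= eqxx mulr1 big1 => [|l /andP[_ /negbTE lj]].
      rewrite addr0 subrr; case: eqVneq ij => // ->; by rewrite ltnn.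
    by rewrite eq_sym lj mulr0.
  rewrite big1 => [|l il]; last first.
    case: eqVneq => [jl|_]; last exact: mulr0.
    by move: il; rewrite -jl ltnNge ji.
  rewrite subr0 /G pairing //; move: ji; rewrite leq_eqVlt => /orP[/eqP e2|lt].
    rewrite bc_eq // eq_sym; case: eqVneq => _; first by rewrite mul1r e1.
    by rewrite mul0r dem0.
  rewrite bc_lt // mul0r dem0; case: eqVneq lt => // ->; by rewrite ltnn.
have nd h : inv K h -> (forall i, trace K I (h * E i) = 0) -> h = 0.
  move=> hK hE0; apply: (dem_nondegenerate fI e1) => w Iw'.
  (* If w is some b_i, then d_i is a combination of the E_j, which pair to zero with h; otherwise
     the operator of w^-1 kills R^K. *)
  have [mw|nmw] := pselect (min_right K w^-1%g).
    have [i <-] := b_surj w (conj Iw' mw); rewrite -pairing //.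
    have := hE0 i; rewrite EE mulrBr [X in X = 0 -> _]demB -!/(trace K I _) tr_sum.
    by rewrite big1 ?subr0 // => j _; rewrite hE0 mulr0.
  have [u Ku mu] := min_right_ex K w^-1%g.
  have u1 : u != 1%g by apply/eqP => u1; apply: nmw; rewrite u1 mulg1 in mu.
  by rewrite (dem_invK0 mu Ku u1 hK) mul0r dem0.
have trI h : inv K h -> inv I (trace K I h) := @trace_inv K I KI fI e h e1.
have Bc : free_basis K I c by apply: (dual_basis KI fI trI cK EK cE nd).
exists n, c, E; split=> // [i|i||i].
- by split=> //; exists (len (b i)).
- by split=> //; exists (m0 - len (b i))%N.
- split=> //; apply: (dual_basis KI fI trI EK cK).
    by move=> i j; rewrite mulrC cE eq_sym.
  (* By [Bc] each E_i is an R^I-combination of the c_j, so orthogonality to the c_j implies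
     orthogonality to the E_i. *)
  move=> h hK hc0; apply: nd => // i.
  have [a [[aI ->] _]] := Bc _ (EK i).
  rewrite mulr_sumr [LHS]dem_sum big1 // => j _.
  by rewrite mulrCA [dem _ _](traceM KI fI _ (aI j)) hc0 mulr0.
(* The operator of y = x w_J is that of x after that of w_J. *)
- exists (dem (longest J) (dem (z i) f)); first exact: dem_longest_inv.
  by rewrite -dem_mul.
Qed.

End NilHecke.

(** * The symmetric algebra *)

Section SymmetricAlgebra.
Variables (k : fieldType) (V : vectType k).
Implicit Types (f h : Sym V) (v : V).

Lemma sym_inj_is_linear : linear (@sym_inj k V).
Proof.
move=> a v w; rewrite /sym_inj scaler_sumr -big_split /=; apply: eq_bigr => i _.
by rewrite linearP scalerDl scalerA.
Qed.

HB.instance Definition _ :=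
  GRing.isLinear.Build k V (Sym V) _ (@sym_inj k V) sym_inj_is_linear.

Lemma sym_inj_vbasis i : sym_inj (tnth (vbasis {: V}) i) = 'X_i :> Sym V.
Proof.
rewrite /sym_inj (bigD1 i) //= (tnth_nth 0) coord_free ?(basis_free (vbasisP _)) //.
rewrite eqxx scale1r big1 ?addr0 // => j ji.
by rewrite coord_free ?(basis_free (vbasisP _)) // eq_sym (negbTE ji) scale0r.
Qed.

Lemma sym_inj_inj : injective (@sym_inj k V).
Proof.
move=> v w e; apply/eqP; rewrite -subr_eq0; apply/eqP.
rewrite (coord_vbasis (memvf (v - w))) big1 // => i _.
have : (sym_inj (v - w))@_U_(i) = 0 by rewrite linearB /= e subrr mcoeff0.
rewrite /sym_inj linear_sum /= (bigD1 i) //= big1 ?addr0.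
  by rewrite mcoeffZ mcoeffXU eqxx mulr1 => ->; rewrite scale0r.
by move=> j ji; rewrite mcoeffZ mcoeffXU (negbTE ji) mulr0.
Qed.

Lemma sym_inj_homog v : sym_inj v \is 1.-homog.
Proof.
by apply: rpred_sum => i _; rewrite rpredZ // dhomogX /= mdeg1.
Qed.

Lemma sym_ind (P : Sym V -> Prop) : P 1 ->
  (forall a f h, P f -> P h -> P (a *: f + h)) ->
  (forall v f, P f -> P (sym_inj v * f)) -> forall f, P f.
Proof.
move=> P1 PD PM f.
have P0 : P 0 by have := PD (-1) 1 1 P1 P1; rewrite scaleN1r addNr.
elim/mpolyind: f => // c m f _ _ Pf; apply: PD => //.
rewrite mpolyXE_id; elim/big_rec: _ => // i h _ Ph.
elim: (m i) => [|n IHn]; first by rewrite expr0 mul1r.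
by rewrite exprS -mulrA -{1}sym_inj_vbasis; exact: PM.
Qed.

(** A variable is peeled off a monomial of positive degree; Q n 0 starts from 1 - 1 in degree 0. *)
Lemma sym_homog_ind (Q : nat -> Sym V -> Prop) : Q 0%N 1 ->
  (forall n a f h, Q n f -> Q n h -> Q n (a *: f + h)) ->
  (forall n v f, Q n f -> Q n.+1 (sym_inj v * f)) ->
  forall n f, f \is n.-homog -> Q n f.
Proof.
move=> Q1 QD QM.
have QX n (m : 'X_{1..\dim {: V}}) : mdeg m = n -> Q n 'X_[m].
  elim: n m => [|n IHn] m.
    by move/eqP; rewrite mdeg_eq0 => /eqP->; rewrite mpolyX0.
  move=> mn; have [i mi] : exists i, m i != 0%N.
    apply/existsP; apply: contraT; rewrite negb_exists => /forallP m0.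
    have : mdeg m == 0%N.
      by rewrite mdegE big1 // => i _; apply/eqP; move: (m0 i); rewrite negbK.
    by rewrite mn.
  have mE : (m - U_(i) + U_(i))%MM = m by apply: submK; rewrite lep1mP.
  rewrite -mE mpolyXD mulrC -sym_inj_vbasis; apply: QM; apply: IHn.
  by move: mn; rewrite -mE mdegD mdeg1 addn1 => -[]; rewrite {1}mE.
have Q0 n : Q n 0.
  elim: n => [|n IHn]; first by have := QD 0%N (-1) 1 1 Q1 Q1; rewrite scaleN1r addNr.
  by have := QM n 0 0 IHn; rewrite mulr0.
move=> n f /dhomogP fh; rewrite (mpolyE f) big_seq_cond.
apply: (big_ind (Q n)) => // [p q Qp Qq|m].
  by have := QD n 1 p q Qp Qq; rewrite scale1r.
rewrite andbT => /fh /QX Qm; have := QD n f@_m _ 0 Qm (Q0 n).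
by rewrite addr0.
Qed.

Variable g : 'End(V).

Lemma sym_map1 : sym_map g 1 = 1.
Proof. exact: comp_mpoly1. Qed.

Lemma sym_mapP a f h : sym_map g (a *: f + h) = a *: sym_map g f + sym_map g h.
Proof. exact: linearP. Qed.

Lemma sym_mapM f h : sym_map g (f * h) = sym_map g f * sym_map g h.
Proof. exact: rmorphM. Qed.

Lemma sym_map_inj v : sym_map g (sym_inj v) = sym_inj (g v).
Proof.
rewrite {2}(coord_vbasis (memvf v)) !linear_sum /sym_map raddf_sum /=.
apply: eq_bigr => i _; rewrite !linearZ /= /comp_mpoly mmapX mmap1U tnth_mktuple.
by rewrite (tnth_nth 0).
Qed.

End SymmetricAlgebra.

(** * Demazure operators on the symmetric algebra *)

Section Realization.
Variables (k : fieldType) (C : coxeter_system) (V : realization k C).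

Lemma sym_actP x a (f h : Sym V) :
  sym_act x (a *: f + h) = a *: sym_act x f + sym_act x h.
Proof. exact: sym_mapP. Qed.

Lemma sym_actM x (f h : Sym V) : sym_act x (f * h) = sym_act x f * sym_act x h.
Proof. exact: sym_mapM. Qed.

Lemma sym_act_inj x v : sym_act x (sym_inj v) = sym_inj (ract V x v).
Proof. exact: sym_map_inj. Qed.

(** A zero root would make s act as the identity, against faithfulness. *)
Lemma sym_root_neq0 s : faithful_realization V -> sym_inj (Defs.root V s) != 0.
Proof.
move=> V_faithful.
rewrite -(linear0 (@sym_inj k V)) (inj_eq (@sym_inj_inj _ _)); apply/eqP => r0.
have /V_faithful gs1 : ract V (cox_gen s) = ract V 1%g.
  by apply/lfunP => v; rewrite ract_gen r0 scaler0 subr0 ract1.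
by have := len_gen s; rewrite gs1 len1.
Qed.

Definition sym_iota : {linear V -> (Sym V : comAlgType k)} := @sym_inj k V.

Lemma sym_iota_ind (P : Sym V -> Prop) : P 1 ->
  (forall a f h, P f -> P h -> P (a *: f + h)) ->
  (forall v f, P f -> P (sym_iota v * f)) -> forall f, P f.
Proof. exact: sym_ind. Qed.

Lemma sym_iota_homog_ind (Q : nat -> Sym V -> Prop) : Q 0%N 1 ->
  (forall n a f h, Q n f -> Q n h -> Q n (a *: f + h)) ->
  (forall n v f, Q n f -> Q n.+1 (sym_iota v * f)) ->
  forall n f, f \is n.-homog -> Q n f.
Proof. exact: sym_homog_ind. Qed.

Lemma sym_act1 x : sym_act x 1 = 1 :> Sym V.
Proof. exact: sym_map1. Qed.

Hypothesis V_faithful : faithful_realization V.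

Lemma sym_root_reg s (f h : Sym V) :
  f * sym_iota (Defs.root V s) = h * sym_iota (Defs.root V s) -> f = h.
Proof. exact: (mulIf (sym_root_neq0 s V_faithful)). Qed.

(** The quotient exists by [divided_difference_ex], so the choice in [demazure_gen] is a true
    quotient. *)
Lemma demazure_genE s (f : Sym V) :
  demazure_gen s f * sym_iota (Defs.root V s) = f - sym_act (cox_gen s) f.
Proof.
apply: (@xgetPex _ 0 [set q : Sym V | q * sym_inj (Defs.root V s) =
  f - sym_act (cox_gen s) f]).
exact: (@divided_difference_ex k C V (Sym V) sym_iota (@sym_act k C V)
  sym_iota_ind sym_act1 sym_actP sym_actM sym_act_inj s f).
Qed.

Lemma sym_homogP n a (f h : Sym V) :
  f \is n.-homog -> h \is n.-homog -> a *: f + h \is n.-homog.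
Proof. by move=> fn hn; apply: dhomogD => //; exact: dhomogZ. Qed.

Lemma sym_homog0 n : (0 : Sym V) \is n.-homog.
Proof. exact: dhomog0. Qed.

Lemma sym_homog1 : (1 : Sym V) \is 0.-homog.
Proof. exact: dhomog1. Qed.

Lemma sym_homogM m n (f h : Sym V) :
  f \is m.-homog -> h \is n.-homog -> f * h \is (m + n).-homog.
Proof. exact: dhomogM. Qed.

Definition sym_proj n :
  {linear (Sym V : comAlgType k) -> (Sym V : comAlgType k)} := pihomog mdeg n.

(** Surjectivity is applied to the invariant 1, and the preimage is replaced by a homogeneous
    component. *)
Lemma homogeneous_preimage_one (I : set (cox_index C)) : demazure_surjective V ->
  finitary I ->
  exists2 e : Sym V, e \is (cox_length (longest I)).-homog &
    demazure (longest I) e = 1.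
Proof.
move=> V_surjective fI.
have [|f f1] := V_surjective I fI 1; first by move=> x _; exact: sym_act1.
apply: (@homogeneous_preimage k C V (Sym V) sym_iota (@sym_act k C V)
  sym_act1 sym_actP sym_actM sym_act_inj sym_root_reg
  (@demazure_gen k C V) demazure_genE (fun n (h : Sym V) => h \is n.-homog)
  sym_homog0 sym_homog1 (@sym_inj_homog k V) sym_homogP
  sym_homogM sym_iota_homog_ind sym_proj (longest I) f) => //.
- by move=> n h; exact: pihomogP.
- by move=> n h; exact: pihomog_dE.
- by move=> m n h; exact: pihomog_ne0.
- move=> h; exists (msize h) => M hM; exact: pihomog_partitionE.
Qed.

End Realization.

Theorem theorem4p15 (C : coxeter_system) (k : fieldType) (V : realization k C)
    (V_faithful : faithful_realization V) (V_balanced : balanced V)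
    (V_surjective : demazure_surjective V)
    (I J L : set (cox_index C)) (IJL : I `|` J `<=` L) (L_fin : finitary L)
    (p : set C) (p_coset : is_dcoset I J p) (p_sub : p `<=` parabolic L) :
  exists (n : nat) (c d : 'I_n -> Sym V),
    dual_bases (left_redundancy I J p) I c d /\
    ((forall i, (demazure (dcoset_min p) @` invariants J) (c i)) \/
     (forall i, (demazure (dcoset_min p) @` invariants J) (d i))).
Proof.
have [px mx] := dcoset_minP p_coset.
have IL : I `<=` L by move=> s Is; apply: IJL; left.
have JL : J `<=` L by move=> s Js; apply: IJL; right.
have [e he e1] := homogeneous_preimage_one V_faithful V_surjective (finitaryS IL L_fin).
have [f hf f1] := homogeneous_preimage_one V_faithful V_surjective L_fin.
have [n [c [d [cP dP [Bc Bd] cd im]]]] :=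
  @dual_bases_in_image k C V (Sym V) (sym_iota V) (@sym_act k C V)
    (@sym_iota_ind _ _ V) (@sym_act1 _ _ V) (@sym_actP _ _ V) (@sym_actM _ _ V)
    (@sym_act_inj _ _ V) (@sym_root_reg _ _ V V_faithful)
    (@demazure_gen k C V) (@demazure_genE _ _ V) V_balanced
    (fun n (h : Sym V) => h \is n.-homog)
    (@sym_homog0 _ _ V) (@sym_homog1 _ _ V) (@sym_inj_homog k V) (@sym_homogP _ _ V)
    (@sym_homogM _ _ V) (@sym_iota_homog_ind _ _ V)
    I J L (dcoset_min p) e f IL JL L_fin (p_sub _ px) mx he e1 hf f1.
exists n, c, d; split; last by left=> i; have [h hJ <-] := im i; exists h.
by split.
Qed.
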